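(* Let $s\in(1,2]$, let $\alpha$ be a cardinal number with $\alpha\geq\aleph_0$, and let $p\in\{1,2\}$. Then the set $H_s[0,1]=\{f\in C[0,1]:\dim_H G_f([0,1])=s\}$ is $(p,\mathfrak{c})$-spaceable in $C[0,1]$, but it is not $(\alpha,\beta)$-spaceable for any cardinal number $\beta$.
   Context: $C[0,1]$ is the real Banach space of real-valued continuous functions on $[0,1]$ with the maximum norm. For a function $f$ defined on $X\subseteq\mathbb{R}$, $G_f(X)=\{(x,f(x)):x\in X\}$ is its graph over $X$, and $\dim_H$ denotes Hausdorff dimension. $\mathfrak{c}$ is the cardinality of $\mathbb{R}$ and $\aleph_0$ that of $\mathbb{N}$. For cardinals $\alpha<\beta$, a subset $A$ of a topological vector space $X$ is called $\alpha$-lineable if there is an $\alpha$-dimensional linear subspace $M$ with $M\subseteq A\cup\{0\}$; it is called $(\alpha,\beta)$-spaceable if it is $\alpha$-lineable and for every $\alpha$-dimensional subspace $W_\alpha\subseteq A\cup\{0\}$ there is a closed $\beta$-dimensional subspace $W_\beta$ with $W_\alpha\subseteq W_\beta\subseteq A\cup\{0\}$. *)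

(* Defs.v *)
From HB Require Import structures.
From mathcomp Require Import all_boot all_order all_algebra.
From mathcomp Require Import all_classical all_reals all_analysis.
Set Implicit Arguments. Unset Strict Implicit. Unset Printing Implicit Defensive.
Import Order.TTheory GRing.Theory Num.Theory.
Import numFieldNormedType.Exports.
Local Open Scope classical_set_scope.
Local Open Scope ring_scope.

Section Defs.
Variable R : realType.

Definition I01 : set R := `[0, 1].

(** C[0,1] is modelled as the set of functions R -> R that are continuous on
    [0,1] and vanish outside [0,1] (one canonical representative per element
    of C[0,1]); the vector operations are pointwise. *)
Definition zerof : R -> R := fun _ => 0.
Definition C01 : set (R -> R) :=
  [set f | {within I01, continuous f} /\ (forall x, ~ I01 x -> f x = 0)].

Definition supnorm (h : R -> R) : R := sup [set `|h x| | x in I01].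

Definition closedC (M : set (R -> R)) : Prop :=
  forall g, C01 g ->
    (forall e : R, 0 < e -> exists f, M f /\ supnorm (fun x => f x - g x) < e) ->
    M g.

Definition subspace (M : set (R -> R)) : Prop :=
  M `<=` C01 /\ M zerof /\
  (forall f g, M f -> M g -> M (fun x => f x + g x)) /\
  (forall (a : R) f, M f -> M (fun x => a * f x)).

Definition lincomb (n : nat) (c : 'I_n -> R) (v : 'I_n -> R -> R) : R -> R :=
  fun x => \sum_(i < n) c i * v i x.

Definition lin_indep (B : set (R -> R)) : Prop :=
  forall (n : nat) (c : 'I_n -> R) (v : 'I_n -> R -> R),
    injective v -> (forall i, B (v i)) -> lincomb c v = zerof ->
    forall i, c i = 0.

Definition is_basis (M B : set (R -> R)) : Prop :=
  B `<=` M /\ lin_indep B /\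
  (forall f, M f -> exists (n : nat) (c : 'I_n -> R) (v : 'I_n -> R -> R),
      (forall i, B (v i)) /\ f = lincomb c v).

Definition has_dim (T : Type) (M : set (R -> R)) : Prop :=
  subspace M /\ exists B, is_basis M B /\ (B #= [set: T])%card.

(** alpha-lineability and (alpha,beta)-spaceability, cardinals given as types *)
Definition lineable (TA : Type) (A : set (R -> R)) : Prop :=
  exists M, has_dim TA M /\ M `<=` A `|` [set zerof].

Definition spaceable (TA TB : Type) (A : set (R -> R)) : Prop :=
  lineable TA A /\
  forall W, has_dim TA W -> W `<=` A `|` [set zerof] ->
    exists V, has_dim TB V /\ closedC V /\ W `<=` V /\ V `<=` A `|` [set zerof].

Definition dist2 (p q : R * R) : R :=
  Num.sqrt ((p.1 - q.1) ^+ 2 + (p.2 - q.2) ^+ 2).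

Definition diam (U : set (R * R)) : R :=
  sup [set dist2 p q | p in U & q in U].

Definition hcost (s : R) (U : set (R * R)) : \bar R :=
  if `[< U = set0 >] then 0%E else ((diam U) `^ s)%:E.

Definition Hdelta (s d : R) (E : set (R * R)) : \bar R :=
  ereal_inf [set (\sum_(i <oo) hcost s (U i))%E | U in
    [set U : nat -> set (R * R) |
       E `<=` \bigcup_i U i /\
       (forall i p q, U i p -> U i q -> dist2 p q <= d)]].

(** H^s(E) = lim_{delta -> 0+} H^s_delta(E) = sup_{delta > 0} H^s_delta(E) *)
Definition Hmeasure (s : R) (E : set (R * R)) : \bar R :=
  ereal_sup [set Hdelta s d E | d in [set d : R | 0 < d]].

Definition dimH (E : set (R * R)) : \bar R :=
  ereal_inf [set s%:E | s in [set s : R | 0 <= s /\ Hmeasure s E = 0%E]].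

Definition graph (f : R -> R) (X : set R) : set (R * R) :=
  [set xy | X xy.1 /\ xy.2 = f xy.1].

Definition Hs (s : R) : set (R -> R) :=
  [set f | C01 f /\ dimH (graph f I01) = s%:E].

End Defs.

(* Main.v *)
(** Failure in infinite dimension. If M is an infinite-dimensional subspace of
    Hs s together with 0, with independent vectors b_n, replace each b_n by
    eps_n b_n + x, where eps_n b_n tends to 0 uniformly. Adding a Lipschitz function
    does not change the dimension of a graph, so the new span is still contained in
    Hs s together with 0, but every closed subspace containing it contains the
    function x, whose graph has dimension 1 < s.

    Extension in finite dimension. Let W be spanned by finitely many functions and let
    K be a Cantor set of dimension s - 1. If h is Lipschitz off every neighbourhood of
    K, then adding a h to w in W can raise the dimension of the graph only over K, where
    it is at most (s - 1) + 1 = s; hence w + a h never exceeds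
    dimension s. If moreover h oscillates on K on scales far below those at which the
    functions of W vary, then the graph of w + a h over K has dimension at least s for
    every w in W and a <> 0, by a counting form of the mass distribution principle.
    Multiplying h by Lipschitz windows phi_j with disjoint supports yields a closed
    space of functions, all of the form a_j phi_j h on the j-th window, whose sum with
    W is the required extension; W is split off by finitely many point evaluations,
    which keeps the sum closed. Its Hamel dimension is that of the continuum because
    the sequences (t^j)_j with 0 < t < 1 are independent. *)

Require Import Defs.
From HB Require Import structures.
From mathcomp Require Import all_boot all_order all_algebra.
From mathcomp Require Import all_classical all_reals all_analysis.
From mathcomp Require Import zify ring lra.
Import Order.TTheory GRing.Theory Num.Theory.
Import numFieldNormedType.Exports.
Local Open Scope classical_set_scope.
Local Open Scope ring_scope.
Set Implicit Arguments.
Unset Strict Implicit.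
Unset Printing Implicit Defensive.

(** * Square covers and Hausdorff dimension *)

(** On K the function h is a sum of waves with weights 2 ^- k, the k-th of which reads one block of
    binary digits of the point as a fraction. Take a square of half-side r, with 2 ^- m about r ^ (s
    - 1). Its width fixes the first m digits of the points of K that it meets. Its height, once the
    digits outside the k-th block are given, confines that block to a proportion of about r 2 ^ k of
    its values. So the square meets a proportion of about 2 ^- m r 2 ^ k of all words, which is r ^
    s up to the loss 2 ^ k. Choosing k with k ^ 2 <= m < (k + 1) ^ 2 makes this loss subexponential
    in m, so every exponent t < s survives. The functions of W do not interfere, since the k-th
    block starts only at a level where they vary by at most a constant times r. For s = 2 the ratio
    of K is 1/2 and bare geometric lengths would leave no gaps; the polynomial factors that open
    them disappear in the same slack. *)

Section SquareCovers.
Variable R : realType.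
Implicit Types (E : set (R * R)) (t e r : R).

Definition square (c : R * R) r : set (R * R) :=
  [set p | `|p.1 - c.1| <= r /\ `|p.2 - c.2| <= r].

(** Bounding all partial sums avoids infinite sums. The sizes of the squares are left free: a small
    total already forces each of them to be small. *)
Definition content_le t E e := exists (c : nat -> R * R) (r : nat -> R),
  [/\ forall i, 0 <= r i, E `<=` \bigcup_i square (c i) (r i)
    & forall n, \sum_(i < n) r i `^ t <= e].

Definition null_content t E := forall e, 0 < e -> content_le t E e.

Lemma sum_delta_le (n c : nat) (x : R) : 0 <= x ->
  \sum_(k < n) (if k == c :> nat then x else 0) <= x.
Proof.
move=> x0; elim: n => [|n IH]; first by rewrite big_ord0.
rewrite big_ord_recr /=; case: eqP => [nc|_]; last by rewrite addr0.
rewrite big1 ?add0r // => i _; case: eqP => // ic.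
by have := ltn_ord i; rewrite ic -nc ltnn.
Qed.

Definition unpair_sum (a : nat -> nat -> R) (k : nat) : R :=
  if (pickle_inv k : option (nat * nat)) is Some p then a p.1 p.2 else 0.

Lemma sum_unpair_le (a : nat -> nat -> R) (b : nat -> R) e :
  (forall i j, 0 <= a i j) -> (forall i n, \sum_(j < n) a i j <= b i) ->
  (forall n, \sum_(i < n) b i <= e) ->
  forall n, \sum_(k < n) unpair_sum a k <= e.
Proof.
move=> a0 ab be n.
pose m (k : nat) := if (pickle_inv k : option (nat * nat)) is Some p
  then (p.1 + p.2).+1 else 0%N.
pose M := (\max_(k < n) m k)%N.
apply: (@le_trans _ _ (\sum_(k < n) \sum_(i < M) \sum_(j < M)
   (if k == pickle (i : nat, j : nat) :> nat then a i j else 0))).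
  apply: ler_sum => k _; rewrite /unpair_sum.
  have Mk : (m k <= M)%N by apply: (leq_bigmax k).
  have ge0 (i j : nat) :
      0 <= (if k == pickle (i, j) :> nat then a i j else 0).
    by case: ifP.
  move: Mk; rewrite /m; case E : (pickle_inv _) => [[i j]|] /= Mk.
    have iM : (i < M)%N by apply: leq_trans Mk; rewrite ltnS leq_addr.
    have jM : (j < M)%N by apply: leq_trans Mk; rewrite ltnS leq_addl.
    rewrite (bigD1 (Ordinal iM)) //= (bigD1 (Ordinal jM)) //=.
    have kE : k = pickle (i, j) :> nat.
      by have := @pickle_invK (nat * nat)%type k; rewrite E /= => ->.
    rewrite -kE eqxx -addrA lerDl addr_ge0 ?sumr_ge0 // => x _.
    by rewrite sumr_ge0.
  by rewrite sumr_ge0 // => x _; rewrite sumr_ge0.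
rewrite exchange_big /=.
apply: le_trans (be M); apply: ler_sum => i _.
rewrite exchange_big /=; apply: le_trans (ab i M); apply: ler_sum => j _.
exact: sum_delta_le.
Qed.

Lemma content_le_bigcup t (E : nat -> set (R * R)) (b : nat -> R) e : 0 < t ->
  (forall n, content_le t (E n) (b n)) -> (forall n, \sum_(i < n) b i <= e) ->
  content_le t (\bigcup_n E n) e.
Proof.
move=> t0 /choice[c] /choice[r] H be.
pose c' k := if (pickle_inv k : option (nat * nat)) is Some p then c p.1 p.2 else 0.
exists c', (unpair_sum r); split.
- move=> k; rewrite /unpair_sum; case: pickle_inv => // p.
  by have [] := H p.1.
- move=> p [n _ Enp]; have [_ /(_ p Enp) [j _ pj] _] := H n.
  exists (@pickle (nat * nat)%type (n, j)) => //.
  by rewrite /c' /unpair_sum pickleK_inv.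
- move=> n; rewrite (eq_bigr (fun k : 'I_n =>
    unpair_sum (fun i j => r i j `^ t) k)); last first.
    move=> k _; rewrite /unpair_sum; case: pickle_inv => //.
    by rewrite powR0 // gt_eqF.
  apply: sum_unpair_le be _ => // [i j|i]; first exact: powR_ge0.
  by have [] := H i.
Qed.

Lemma content_leW t E F e e' : E `<=` F -> e <= e' ->
  content_le t F e -> content_le t E e'.
Proof.
move=> EF ee [c [r [r0 cr re]]]; exists c, r; split => //.
  exact: subset_trans cr.
by move=> n; apply: le_trans ee.
Qed.

Lemma content_le_square t (c : R * R) r : 0 < t -> 0 <= r ->
  content_le t (square c r) (r `^ t).
Proof.
move=> t0 r0; exists (fun=> c), (fun i => if i == 0%N then r else 0); split.
- by move=> i; case: ifP.
- by move=> p; exists 0%N.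
- move=> n; apply: le_trans (sum_delta_le n 0 (powR_ge0 r t)).
  apply: ler_sum => i _; case: ifP => // _.
  by rewrite powR0 // gt_eqF.
Qed.

Lemma content_le_set0 t e : 0 < t -> 0 <= e -> content_le t set0 e.
Proof.
move=> t0 e0; exists (fun=> 0), (fun=> 0); split => // n.
by rewrite big1 // => i _; rewrite powR0 // gt_eqF.
Qed.

Lemma content_le_fin t (I : finType) (E : I -> set (R * R)) e : 0 < t -> 0 <= e ->
  (forall i, content_le t (E i) e) ->
  content_le t [set p | exists i, E i p] (#|I|%:R * e).
Proof.
move=> t0 e0 H.
pose E' (n : nat) := [set p | exists2 i, enum_rank i = n :> nat & E i p].
apply: (@content_leW _ _ (\bigcup_n E' n) _ _ _ (lexx _)).
  by move=> p [i Eip]; exists (enum_rank i : nat) => //; exists i.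
apply: (@content_le_bigcup _ _ (fun n => if (n < #|I|)%N then e else 0)) => //.
  move=> n; case: ltnP => nI.
    apply: content_leW (H (enum_val (Ordinal nI))) => // p [i iE].
    by suff -> : i = enum_val (Ordinal nI) by [];
      rewrite -[LHS]enum_rankK; congr enum_val; exact: val_inj.
  apply: content_leW (content_le_set0 t0 (lexx 0)) => // p [i iE _].
  by have := ltn_ord (enum_rank i); rewrite iE ltnNge nI.
move=> n; rewrite (_ : \sum_(i < n) _ = (minn n #|I|)%:R * e).
  by rewrite ler_wpM2r // ler_nat geq_minr.
elim: n => [|n IH]; first by rewrite big_ord0 min0n mul0r.
rewrite big_ord_recr /= IH /minn; case: (ltnP n.+1) => nI.
  by rewrite (ltnW nI) -[in RHS]addn1 natrD; ring.
case: ltnP => nI'; last by rewrite addr0.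
by have -> : #|I| = n.+1; [apply/eqP; rewrite eqn_leq nI nI'|rewrite -[in RHS]addn1 natrD; ring].
Qed.

Lemma geo_half_sum (e : R) n : 0 <= e -> \sum_(i < n) e * 2^-1 ^+ i.+1 <= e.
Proof.
move=> e0; have -> : \sum_(i < n) e * 2^-1 ^+ i.+1 = e - e * 2^-1 ^+ n.
  elim: n => [|n IH]; first by rewrite big_ord0 expr0; lra.
  by rewrite big_ord_recr /= IH !exprS; lra.
by rewrite gerBl mulr_ge0 // exprn_ge0.
Qed.

Lemma null_content_bigcup t (E : nat -> set (R * R)) : 0 < t ->
  (forall n, null_content t (E n)) -> null_content t (\bigcup_n E n).
Proof.
move=> t0 H e e0.
apply: (@content_le_bigcup _ _ (fun i => e * 2^-1 ^+ i.+1)) => //.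
  by move=> n; apply: H; rewrite mulr_gt0 // exprn_gt0.
by move=> n; apply: geo_half_sum; exact: ltW.
Qed.

Lemma null_contentW t E F : E `<=` F -> null_content t F -> null_content t E.
Proof. by move=> EF H e e0; apply: content_leW (H e e0). Qed.

Lemma null_contentU t E F : 0 < t -> null_content t E -> null_content t F ->
  null_content t (E `|` F).
Proof.
move=> t0 HE HF.
apply: (@null_contentW _ _ (\bigcup_n (if n == 0%N then E else F))).
  by move=> p [Ep|Fp]; [exists 0%N|exists 1%N].
by apply: null_content_bigcup => // n; case: ifP.
Qed.

(** Each square that meets the graph is recentred at a graph point inside it. Two abscissas of the
    square differ by at most 2 r, so [g] varies there by at most 2 L r, and the enlargement by K = 2
    + 2 L only costs the factor K ^ t. *)
Lemma null_content_shear t (f g : R -> R) (A : set R) L : 0 < t -> 0 <= L ->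
  (forall x y, A x -> A y -> `|g x - g y| <= L * `|x - y|) ->
  null_content t (graph f A) -> null_content t (graph (fun x => f x + g x) A).
Proof.
move=> t0 L0 gL H e e0; set K := 2 + 2 * L.
have K0 : 0 < K by rewrite /K; lra.
have Kt : 0 < K `^ t by exact: powR_gt0.
have [c [r [r0 cr re]]] := H (e / K `^ t) (divr_gt0 e0 Kt).
have /choice[z zP] : forall i, exists z, (exists2 x, A x & square (c i) (r i) (x, f x)) ->
    A z /\ square (c i) (r i) (z, f z).
  move=> i; have [[x Ax Sx]|N] := pselect (exists2 x, A x & square (c i) (r i) (x, f x)).
    by exists x.
  by exists 0 => /N.
exists (fun i => (z i, f (z i) + g (z i))), (fun i => K * r i); split.
- by move=> i; rewrite mulr_ge0 // ltW.
- move=> [x y] [/= Ax ->].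
  have [i _ Si] := cr (x, f x) (conj Ax erefl).
  have [Az [/= z1 z2]] := zP i (ex_intro2 _ _ x Ax Si).
  case: Si => /= s1 s2.
  exists i => //=; rewrite /square /=.
  have xz : `|x - z i| <= 2 * r i.
    rewrite (_ : x - z i = (x - (c i).1) - (z i - (c i).1)); last by ring.
    by apply: (le_trans (ler_normB _ _)); lra.
  have fz : `|f x - f (z i)| <= 2 * r i.
    rewrite (_ : f x - f (z i) = (f x - (c i).2) - (f (z i) - (c i).2)); last by ring.
    by apply: (le_trans (ler_normB _ _)); lra.
  have gz : `|g x - g (z i)| <= L * (2 * r i).
    by apply: (le_trans (gL _ _ Ax Az)); rewrite ler_wpM2l.
  split.
    apply: (le_trans xz); rewrite ler_wpM2r // /K; lra.
  rewrite opprD addrACA; apply: (le_trans (ler_normD _ _)).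
  rewrite (_ : K * r i = 2 * r i + L * (2 * r i)); last by rewrite /K; ring.
  exact: lerD.
- move=> n; rewrite (eq_bigr (fun i : 'I_n => K `^ t * r i `^ t)); last first.
    by move=> i _; rewrite powRM //; exact: ltW.
  by rewrite -mulr_sumr mulrC -ler_pdivlMr //; exact: re.
Qed.

End SquareCovers.

(** * Null content compared with Hausdorff measure and dimension *)

Section HausdorffDimension.
Variable R : realType.
Implicit Types (E : set (R * R)) (t e r : R).

Lemma hcost_ge0 t (U : set (R * R)) : (0 <= hcost t U)%E.
Proof. by rewrite /hcost; case: asboolP => // _; rewrite lee_fin powR_ge0. Qed.

Lemma dist2_ge (p q : R * R) : `|p.1 - q.1| <= dist2 p q /\ `|p.2 - q.2| <= dist2 p q.
Proof.
split; rewrite /dist2 -sqrtr_sqr ler_sqrt ?addr_ge0 ?sqr_ge0 //.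
  by rewrite lerDl sqr_ge0.
by rewrite lerDr sqr_ge0.
Qed.

(** A total cost below 1/2 forces all diameters below 1, where raising the exponent lowers the cost.
    The new exponent is positive even if [t] is 0, so that empty and one-point pieces fit in squares
    of radius 0 at no cost. *)
Lemma Hmeasure0_null_content t t' E : 0 <= t -> t < t' ->
  Hmeasure t E = 0%E -> null_content t' E.
Proof.
move=> t0 tt' H0 e e0.
have t'0 : 0 < t' by exact: le_lt_trans tt'.
pose e1 := Num.min e 2^-1.
have e10 : 0 < e1 by rewrite lt_min e0 /=; lra.
have : (Hdelta t 1 E < e1%:E)%E.
  apply: (@le_lt_trans _ _ 0%E); last by rewrite lte_fin.
  rewrite -H0; apply: ereal_sup_ubound; exists 1 => //=; exact: ltr01.
move=> /ereal_inf_lt[_ [U [EU U1] <-]] Ue.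
have psum n : (\sum_(0 <= i < n) hcost t (U i) <= e1%:E)%E.
  apply: le_trans (ltW Ue); apply: nneseries_lim_ge => i _ _.
  exact: hcost_ge0.
have one i : (hcost t (U i) <= e1%:E)%E.
  apply: le_trans (psum i.+1); rewrite big_nat_recr //= leeDr //.
  by rewrite sume_ge0 // => j _; exact: hcost_ge0.
have /choice[c] : forall i, exists c : (R * R) * R, [/\ 0 <= c.2,
    U i `<=` square c.1 c.2 & ((c.2 `^ t')%:E <= hcost t (U i))%E].
  move=> i; have := one i; rewrite /hcost; case: asboolP => [U0 _|/eqP/set0P[p Up]].
    exists (0, 0); split => //=; first by rewrite U0.
    by rewrite powR0 // gt_eqF.
  have ub : has_sup [set dist2 p q | p in U i & q in U i].
    split; first by exists (dist2 p p); exists p => //; exists p.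
    by exists 1 => _ [q Uq [q' Uq' <-]]; exact: (U1 i).
  have diamP q q' : U i q -> U i q' -> dist2 q q' <= diam (U i).
    by move=> Uq Uq'; apply: ub_le_sup; [case: ub|exists q => //; exists q'].
  have diam0 : 0 <= diam (U i).
    by apply: le_trans (diamP p p Up Up); apply: sqrtr_ge0.
  rewrite lee_fin => d1; exists (p, diam (U i)); split => //=.
    move=> q Uq; have [q1 q2] := dist2_ge q p.
    by split; [apply: le_trans q1 _|apply: le_trans q2 _]; apply: diamP.
  rewrite lee_fin; have [->|dn0] := eqVneq (diam (U i)) 0.
    by rewrite powR0 ?gt_eqF // powR_ge0.
  have dgt0 : 0 < diam (U i) by rewrite lt_neqAle eq_sym dn0.
  have dlt1 : diam (U i) < 1.
    rewrite ltNge; apply/negP => d1'.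
    have : 1 `^ t <= diam (U i) `^ t by rewrite ge0_ler_powR // nnegrE.
    rewrite powR1.
    have : e1 <= 2^-1 by rewrite /e1 ge_min lexx orbT.
    by move: d1; lra.
  by rewrite ger_powR ?dgt0 ?ltW.
move=> cP; exists (fun i => (c i).1), (fun i => (c i).2); split.
- by move=> i; have [] := cP i.
- by move=> p /EU[i _ Uip]; exists i => //; have [_ + _] := cP i; apply.
- move=> n; have : ((\sum_(i < n) (c i).2 `^ t')%:E <= e1%:E)%E.
    rewrite -sumEFin; apply: le_trans (psum n); rewrite big_mkord.
    by apply: lee_sum => i _; have [] := cP i.
  by rewrite lee_fin => /le_trans; apply; rewrite ge_min lexx.
Qed.

(** The mesh condition comes for free: if the sum of the r_i ^ t is at most (d / 3) ^ t, every r_i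
    is at most d / 3, and a square of half-side r has diameter at most 3 r. *)
Lemma null_content_Hmeasure0 t E : 0 < t -> null_content t E -> Hmeasure t E = 0%E.
Proof.
move=> t0 H; apply/eqP; rewrite eq_le; apply/andP; split; last first.
  apply: ereal_sup_ge; exists (Hdelta t 1 E); first by exists 1 => //=; exact: ltr01.
  apply: le_ereal_inf_tmp => _ [U _ <-].
  by apply: nneseries_ge0 => i _ _; exact: hcost_ge0.
apply: ge_ereal_sup => _ [d /= d0 <-].
apply/lee_addgt0Pr => e e0; rewrite add0e.
have Kt : 0 < 3 `^ t :> R by apply: powR_gt0; lra.
pose e1 := Num.min (e / 3 `^ t) ((d / 3) `^ t).
have e10 : 0 < e1 by rewrite lt_min divr_gt0 // powR_gt0 // divr_gt0.
have [c [r [r0 cr re]]] := H e1 e10.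
have dist i p q : square (c i) (r i) p -> square (c i) (r i) q -> dist2 p q <= 3 * r i.
  move=> [p1 p2] [q1 q2]; rewrite /dist2.
  have ri0 := r0 i.
  rewrite -[leRHS]ger0_norm ?mulr_ge0 // -sqrtr_sqr ler_sqrt ?sqr_ge0 //.
  have h1 : `|p.1 - q.1| <= 2 * r i.
    rewrite (_ : p.1 - q.1 = (p.1 - (c i).1) - (q.1 - (c i).1)); last by ring.
    by apply: (le_trans (ler_normB _ _)); lra.
  have h2 : `|p.2 - q.2| <= 2 * r i.
    rewrite (_ : p.2 - q.2 = (p.2 - (c i).2) - (q.2 - (c i).2)); last by ring.
    by apply: (le_trans (ler_normB _ _)); lra.
  rewrite -[X in X + _]real_normK ?num_real // -[X in _ + X]real_normK ?num_real //.
  have := normr_ge0 (p.1 - q.1); have := normr_ge0 (p.2 - q.2).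
  by move: h1 h2; nra.
have rd i : 3 * r i <= d.
  rewrite -ler_pdivlMl // mulrC leNgt; apply/negP => dr.
  have : (d / 3) `^ t < r i `^ t.
    by apply: gt0_ltr_powR => //; rewrite ?nnegrE //; lra.
  have : r i `^ t <= e1.
    apply: le_trans (re i.+1); rewrite big_ord_recr /= lerDr sumr_ge0 // => j _.
    exact: powR_ge0.
  have : e1 <= (d / 3) `^ t by rewrite ge_min lexx orbT.
  by lra.
apply: (@le_trans _ _ (\sum_(i <oo) hcost t (square (c i) (r i)))%E).
  apply: ereal_inf_lbound; exists (fun i => square (c i) (r i)) => //; split => //.
  by move=> i p q sp sq; apply: le_trans (dist i p q sp sq) (rd i).
apply: lime_le.
  by apply: is_cvg_nneseries => i _ _; exact: hcost_ge0.
near=> n; rewrite big_mkord.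
apply: (@le_trans _ _ (\sum_(i < n) ((3 `^ t) * r i `^ t)%:E)%E).
  apply: lee_sum => i _; rewrite /hcost; case: asboolP => [_|/eqP/set0P[p Sp]].
    by rewrite lee_fin mulr_ge0 // powR_ge0.
  rewrite lee_fin -powRM //.
  have ds : diam (square (c i) (r i)) <= 3 * r i.
    apply: ge_sup; first by exists (dist2 p p); exists p => //; exists p.
    by move=> _ [q Sq [q' Sq' <-]]; exact: dist.
  apply: ge0_ler_powR; rewrite ?nnegrE ?mulr_ge0 //; first exact: ltW.
  suff : dist2 p p <= diam (square (c i) (r i)) by move=> dp; exact: (le_trans (sqrtr_ge0 _) dp).
  apply: ub_le_sup; last by exists p => //; exists p.
  by exists (3 * r i) => _ [q Sq [q' Sq' <-]]; exact: dist.
rewrite sumEFin lee_fin -mulr_sumr mulrC -ler_pdivlMr //.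
by apply: le_trans (re n) _; rewrite ge_min lexx.
Unshelve. all: by end_near.
Qed.

Lemma dimH_null_content s t E : s < t -> dimH E = s%:E -> null_content t E.
Proof.
move=> st dE; have : (dimH E < t%:E)%E by rewrite dE lte_fin.
move=> /ereal_inf_lt[_ [t1 [t10 Ht1] <-]]; rewrite lte_fin => t1t.
exact: Hmeasure0_null_content Ht1.
Qed.

Lemma dimH_eq s E : 1 < s -> (forall t, s < t -> null_content t E) ->
  (forall t, 1 < t -> t < s -> ~ null_content t E) -> dimH E = s%:E.
Proof.
move=> s1 ub lb; apply/eqP; rewrite eq_le; apply/andP; split.
  apply/lee_addgt0Pr => e e0; apply: ereal_inf_lbound; exists (s + e) => //.
  split; first lra.
  by apply: null_content_Hmeasure0; [lra|apply: ub; lra].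
apply: le_ereal_inf_tmp => _ [t [t0 Ht] <-]; rewrite lee_fin leNgt; apply/negP => ts.
(* Strictly above both [t] and 1 and strictly below [s], because [lb] speaks only of exponents above
   1. *)
pose t' := (Num.max t 1 + s) / 2.
have m1 : t <= Num.max t 1 by rewrite le_max lexx.
have m2 : 1 <= Num.max t 1 by rewrite le_max lexx orbT.
have m3 : Num.max t 1 < s by rewrite gt_max ts.
apply: (lb t'); rewrite /t'; [lra|lra|].
by apply: Hmeasure0_null_content Ht => //; lra.
Qed.

Lemma dimH_lt s t E : 0 < t -> t < s -> null_content t E -> dimH E <> s%:E.
Proof.
move=> t0 ts H dE; have : (dimH E <= t%:E)%E.
  apply: ereal_inf_lbound; exists t => //; split; first exact: ltW.
  exact: null_content_Hmeasure0.
by rewrite dE lee_fin leNgt ts.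
Qed.

Lemma null_content_shearK t (f g : R -> R) (A : set R) L : 0 < t -> 0 <= L ->
  (forall x y, A x -> A y -> `|g x - g y| <= L * `|x - y|) ->
  null_content t (graph (fun x => f x + g x) A) -> null_content t (graph f A).
Proof.
move=> t0 L0 gL H.
have -> : f = (fun x => f x + g x + (- g x)) by apply/funext => x; rewrite addrK.
apply: (@null_content_shear _ _ _ _ _ L) => // x y Ax Ay.
by rewrite -opprD normrN; exact: gL.
Qed.

End HausdorffDimension.

(** * Subspaces of C[0,1] *)

Section ContinuousFunctions.
Variable R : realType.
Implicit Types (f g : R -> R) (M B S : set (R -> R)).

Lemma C01_zerof : C01 (@zerof R).
Proof. by split => // x; apply: cvg_cst. Qed.

Lemma C01D f g : C01 f -> C01 g -> C01 (fun x => f x + g x).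
Proof.
move=> [cf f0] [cg g0]; split; last by move=> x Ix; rewrite f0 // g0 // addr0.
by move=> x; apply: cvgD; [exact: cf|exact: cg].
Qed.

Lemma C01Z (a : R) f : C01 f -> C01 (fun x => a * f x).
Proof.
move=> [cf f0]; split; last by move=> x Ix; rewrite f0 // mulr0.
by move=> x; apply: cvgM; [exact: cvg_cst|exact: cf].
Qed.

Lemma subspace_C01 : Defs.subspace (@C01 R).
Proof.
split; first by move=> f.
split; first exact: C01_zerof.
by split; [exact: C01D|exact: C01Z].
Qed.

Lemma C01_bounded f : C01 f -> exists2 M, 0 <= M & forall x, `|f x| <= M.
Proof.
move=> [cf f0].
have [c _ cM] := EVT_max ler01 cf.
have [d _ dm] := EVT_min ler01 cf.
exists (`|f c| + `|f d|); first by rewrite addr_ge0.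
move=> x; have [Ix|/f0 ->] := pselect (I01 x); last by rewrite normr0 addr_ge0.
have := cM x Ix; have := dm x Ix; rewrite ler_norml => h1 h2.
have := ler_norm (f c); have := ler_norm (- f d); rewrite normrN => h3 h4.
by have := normr_ge0 (f c); have := normr_ge0 (f d); lra.
Qed.

Lemma supnorm_lt f e : C01 f -> 0 < e -> supnorm f < e -> forall x, `|f x| < e.
Proof.
move=> Cf e0 fe x; have [Ix|/(Cf.2 x) ->] := pselect (I01 x); last by rewrite normr0.
apply: le_lt_trans fe; have [M _ fM] := C01_bounded Cf.
apply: ub_le_sup; last by exists x.
by exists M => _ [y _ <-].
Qed.

Lemma supnorm_le f e : (forall x, `|f x| <= e) -> supnorm f <= e.
Proof.
move=> fe; apply: ge_sup; last by move=> _ [x _ <-].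
by exists `|f 0|, 0 => //; rewrite /I01 /= in_itv /= lexx ler01.
Qed.

Lemma C01_modulus f e : C01 f -> 0 < e -> exists2 d, 0 < d &
  forall x y, I01 x -> I01 y -> `|x - y| <= d -> `|f x - f y| <= e.
Proof.
move=> [cf _] e0.
have e20 : 0 < e / 2 by rewrite divr_gt0.
have : near_covering (@I01 R) by apply/compact_near_coveringP; exact: segment_compact.
move=> /(_ R 0^'+ (fun d x => I01 x -> forall y, I01 y -> `|x - y| <= d -> `|f x - f y| <= e)).
move=> /(_ _) [].
  move=> x Ix.
  have /subspace_continuousP/(_ x Ix)/cvgrPdist_lt/(_ _ e20) := cf.
  move=> near_f; have [d /= d0 dP] : exists2 d, 0 < d &
      forall y, ball x d y -> I01 y -> `|f x - f y| < e / 2.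
    by move: near_f => /nbhs_ballP[d d0 dP]; exists d => // y yd Iy; exact: dP.
  have d20 : 0 < d / 2 by rewrite divr_gt0.
  exists (ball x (d / 2), [set z | z < d / 2]).
    split => /=; first exact: nbhsx_ballx.
    exact: nbhs_right_lt.
  move=> [x' z] /= [xx' zd] Ix' y Iy xy.
  have xd : ball x d x'.
    by apply: lt_trans xx' _; lra.
  have yd : ball x d y.
    rewrite /ball /= (_ : x - y = (x - x') + (x' - y)); last by ring.
    apply: (le_lt_trans (ler_normD _ _)).
    by move: xx'; rewrite /ball /=; lra.
  have h1 := dP _ xd Ix'; have h2 := dP _ yd Iy.
  rewrite (_ : f x' - f y = (f x - f y) - (f x - f x')); last by ring.
  apply: (le_trans (ler_normB _ _)); lra.
move=> d /= d0 dP; exists (d / 2); first by rewrite divr_gt0.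
move=> x y Ix Iy xy; apply: (dP (d / 2) _ _ x Ix Ix y Iy xy) => /=.
  by rewrite sub0r normrN gtr0_norm; lra.
by rewrite divr_gt0.
Qed.

Lemma subspace_lincomb M n (c : 'I_n -> R) v :
  Defs.subspace M -> (forall i, M (v i)) -> M (lincomb c v).
Proof.
move=> [_ [M0 [MD MZ]]]; elim: n c v => [|n IH] c v Mv.
  by rewrite (_ : lincomb c v = @zerof R) //; apply/funext => x; rewrite /lincomb big_ord0.
rewrite (_ : lincomb c v = fun x => c ord0 * v ord0 x +
   lincomb (c \o lift ord0) (v \o lift ord0) x).
  by apply: MD; [exact: MZ|apply: IH => i; exact: Mv].
by apply/funext => x; rewrite /lincomb big_ord_recl.
Qed.

Definition lspan B : set (R -> R) := [set f | exists n (c : 'I_n -> R) v,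
  (forall i, B (v i)) /\ f = lincomb c v].

Lemma lspan_sub B M : Defs.subspace M -> B `<=` M -> lspan B `<=` M.
Proof. by move=> sM BM _ [n [c [v [Bv ->]]]]; apply: subspace_lincomb => // i; apply: BM. Qed.

Lemma sub_lspan B : B `<=` lspan B.
Proof.
move=> f Bf; exists 1%N, (fun=> 1), (fun=> f); split => //.
by apply/funext => x; rewrite /lincomb big_ord1 mul1r.
Qed.

Lemma subspace_lspan B : B `<=` @C01 R -> Defs.subspace (lspan B).
Proof.
move=> BC; split; first by apply: lspan_sub => //; exact: subspace_C01.
split.
  exists 0%N, (fun=> 0), (fun=> @zerof R); split; first by case.
  by apply/funext => x; rewrite /lincomb big_ord0.
split.
  move=> _ _ [n [c [v [Bv ->]]]] [m [d [w [Bw ->]]]].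
  pose cd i := match @fintype.split n m i with inl i => c i | inr i => d i end.
  pose vw i := match @fintype.split n m i with inl i => v i | inr i => w i end.
  exists (n + m)%N, cd, vw; split; first by rewrite /vw => i; case: fintype.split.
  apply/funext => x; rewrite /lincomb big_split_ord /=; congr (_ + _); apply: eq_bigr => i _.
    by rewrite /cd /vw -[lshift m i]/(unsplit (inl i)) unsplitK.
  by rewrite /cd /vw -[rshift n i]/(unsplit (inr i)) unsplitK.
move=> a _ [n [c [v [Bv ->]]]]; exists n, (fun i => a * c i), v; split => //.
by apply/funext => x; rewrite /lincomb mulr_sumr; apply: eq_bigr => i _; rewrite mulrA.
Qed.

Lemma has_dim_lspan (T : Type) B : B `<=` @C01 R -> lin_indep B ->
  (B #= [set: T])%card -> has_dim T (lspan B).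
Proof.
move=> BC indB BT; split; first exact: subspace_lspan.
by exists B; split => //; split; [exact: sub_lspan|split].
Qed.

(** Spans allow repeated vectors, whereas independence is tested on injective families; adding up
    the coefficients of equal vectors reconciles the two. *)
Lemma lincomb_inj B n (c : 'I_n -> R) v : (forall i, B (v i)) ->
  exists n' (c' : 'I_n' -> R) v',
    [/\ injective v', forall i, B (v' i) & lincomb c v = lincomb c' v'].
Proof.
move=> Bv; pose s := undup (codom v).
have vs i : (index (v i) s < size s)%N.
  by rewrite index_mem mem_undup codom_f.
pose idx i := Ordinal (vs i).
exists (size s), (fun j => \sum_(i | idx i == j) c i), (fun j => nth (@zerof R) s j); split.
- by move=> i j /eqP; rewrite nth_uniq ?undup_uniq // => /eqP/val_inj.
- move=> j; have : nth (@zerof R) s j \in s by rewrite mem_nth.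
  by rewrite mem_undup => /codomP[i ->].
- apply/funext => x; rewrite /lincomb (partition_big idx predT) //=.
  apply: eq_bigr => j _; rewrite mulr_suml; apply: eq_bigr => i /eqP <-.
  by rewrite /idx /= nth_index // mem_undup codom_f.
Qed.

Lemma lin_indep_setU1 B f : lin_indep B -> ~ lspan B f -> lin_indep (B `|` [set f]).
Proof.
move=> iB nf n c v vinj vB cv0.
have [[i0]|nv] := pselect (exists i, v i = f); last first.
  by apply: iB cv0 => // i; have [//|/= vif] := vB i; case: nv; exists i.
case: n => [|n] in c v vinj vB cv0 i0 *; [by case: i0|move=> vf].
have Bv j : B (v (lift i0 j)).
  have [//|/=] := vB (lift i0 j); rewrite -vf => /vinj/eqP.
  by rewrite eq_sym (negbTE (neq_lift _ _)).
have E x : c i0 * f x + lincomb (c \o lift i0) (v \o lift i0) x = 0.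
  by rewrite -[RHS]/(@zerof R x) -cv0 /lincomb (bigD1_ord i0) //= vf.
have c0 : c i0 = 0.
  apply/eqP/negPn/negP => cn0; apply: nf.
  exists n, (fun j => - (c i0)^-1 * c (lift i0 j)), (v \o lift i0); split => //.
  apply/funext => x; rewrite /lincomb.
  under eq_bigr do rewrite -mulrA.
  rewrite -mulr_sumr; apply: (mulfI cn0).
  rewrite mulrA mulrN divff // mulN1r; apply/eqP.
  by rewrite -addr_eq0; apply/eqP; exact: E.
have cl j : c (lift i0 j) = 0.
  apply: (iB n (c \o lift i0) (v \o lift i0)) => //.
    by move=> a b /= /vinj; exact: lift_inj.
  by apply/funext => x; have := E x; rewrite c0 mul0r add0r.
by move=> i; case: (unliftP i0 i) => [j ->|->].
Qed.

(** Zorn is applied to the part added to [S] rather than to the sets containing [S], so that the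
    union of the empty chain, the empty set, qualifies. *)
Lemma basis_extension M S : Defs.subspace M -> S `<=` M -> lin_indep S ->
  exists2 B, S `<=` B & is_basis M B.
Proof.
move=> sM SM iS.
have [|A [[AM iA] Amax]] := @Zorn_bigcup _ (fun A => A `<=` M /\ lin_indep (S `|` A)).
  move=> F FP Ftot; split; first by move=> f [X /FP[XM _] Xf]; exact: XM.
  move=> n c v vinj vB.
  suff [X [iX XB]] : exists X, lin_indep (S `|` X) /\ forall i, (S `|` X) (v i).
    exact: iX.
  (* Finitely many vectors need only one member of the chain; [X = set0] serves when all of them
     already lie in [S]. *)
  suff [X [XF XB]] : exists X, (X = set0 \/ F X) /\
      forall i, i \in enum 'I_n -> (S `|` X) (v i).
    exists X; split; last by move=> i; apply: XB; rewrite mem_enum.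
    by case: XF => [->|/FP[]//]; rewrite setU0.
  elim: (enum 'I_n) => [|i s [X [XF XB]]]; first by exists set0; split; [left|].
  have [Si|[Y FY Yi]] := vB i.
    exists X; split => // j; rewrite inE => /orP[/eqP ->|]; first by left.
    exact: XB.
  have [X0|FX] := XF.
    exists Y; split; first by right.
    move=> j; rewrite inE => /orP[/eqP ->|/XB]; first by right.
    by rewrite X0 => -[|//]; left.
  have [XY|YX] := Ftot _ _ FX FY.
    exists Y; split; first by right.
    move=> j; rewrite inE => /orP[/eqP ->|/XB[|/XY]]; by [right|left].
  exists X; split => //.
  by move=> j; rewrite inE => /orP[/eqP ->|/XB//]; right; exact: YX.
exists (S `|` A); first by move=> f; left.
have SAM : S `|` A `<=` M by move=> f [/SM|/AM].
split => //; split => // f Mf; apply: contrapT => nf.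
apply: (Amax (A `|` [set f])).
  split; first by move=> g; left.
  move=> /(_ f (or_intror erefl)) Af.
  by apply: nf; apply: sub_lspan; right.
split; first by move=> g [/AM//|->].
by rewrite setUA; exact: lin_indep_setU1.
Qed.

End ContinuousFunctions.

(** * Infinite dimension: spaceability fails *)

Section InfiniteDimensional.
Variable R : realType.

(** The curve is sampled at the multiples of [r]. It is used for a horizontal segment, the graph of
    0, and for the vertical segments above the intervals of the Cantor scheme. *)
Lemma content_le_curve t (gamma : R -> R * R) (M r : R) : 0 < t -> 0 <= M -> 0 < r ->
  (forall u v, `|(gamma u).1 - (gamma v).1| <= `|u - v|) ->
  (forall u v, `|(gamma u).2 - (gamma v).2| <= `|u - v|) ->
  content_le t [set p | exists2 u, 0 <= u <= M & square (gamma u) r p]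
    ((M / r + 1) * (2 * r) `^ t).
Proof.
move=> t0 M0 r0 g1 g2; pose N := Num.truncn (M / r).
have Mr0 : 0 <= M / r by rewrite divr_ge0 // ltW.
pose E (i : 'I_N.+1) := square (gamma (i%:R * r)) (2 * r).
apply: (@content_leW _ _ _ [set p | exists i, E i p] _ _ _ (lexx _)); last first.
  apply: (@content_leW _ _ _ [set p | exists i, E i p] (#|{: 'I_N.+1}|%:R * (2 * r) `^ t)) => //.
    rewrite ler_wpM2r ?powR_ge0 // card_ord -addn1 natrD lerD2r.
    by rewrite truncn_le.
  apply: content_le_fin => //; first exact: powR_ge0.
  by move=> i; apply: content_le_square => //; rewrite mulr_ge0 // ltW.
move=> p [u /andP[u0 uM] [p1 p2]].
have ur0 : 0 <= u / r by rewrite divr_ge0 // ltW.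
have iN : (Num.truncn (u / r) < N.+1)%N.
  by rewrite ltnS; apply: le_truncn; rewrite ler_pdivrMr // mulfVK // gt_eqF.
exists (Ordinal iN); rewrite /E /=.
have /andP[k1 k2] := truncn_itv ur0.
set k := Num.truncn _ in k1 k2 *.
have du : `|u - k%:R * r| <= r.
  move: k1 k2; rewrite ler_pdivlMr // ltr_pdivrMr // -addn1 natrD mulrDl mul1r => k1 k2.
  by rewrite ger0_norm; lra.
split.
  rewrite (_ : p.1 - _ = (p.1 - (gamma u).1) + ((gamma u).1 - (gamma (k%:R * r)).1)); last by ring.
  apply: (le_trans (ler_normD _ _)); have := g1 u (k%:R * r); move: p1 du => /=; lra.
rewrite (_ : p.2 - _ = (p.2 - (gamma u).2) + ((gamma u).2 - (gamma (k%:R * r)).2)); last by ring.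
apply: (le_trans (ler_normD _ _)); have := g2 u (k%:R * r); move: p2 du => /=; lra.
Qed.

(** The identity, cut off where elements of [C01] have to vanish. It jumps at 1, hence is Lipschitz
    on [I01] only. *)
Definition id01 (x : R) : R := if (0 <= x) && (x <= 1) then x else 0.

Lemma id01E x : I01 x -> id01 x = x.
Proof. by rewrite /I01 /= in_itv /= /id01 => ->. Qed.

Lemma C01_id01 : C01 id01.
Proof.
split; last by move=> x; rewrite /I01 /= in_itv /= /id01; case: ifP.
apply: (@subspace_eq_continuous R (@I01 R) R (fun x : R => x) id01) => [x|].
  by rewrite inE => /id01E ->.
by apply: continuous_subspaceT => x; exact: cvg_id.
Qed.

Lemma null_content_id01 (c t : R) : 1 < t -> null_content t (graph (fun x => c * id01 x) (@I01 R)).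
Proof.
move=> t1.
suff H : null_content t (graph (@zerof R) (@I01 R)).
  have -> : (fun x => c * id01 x) = (fun x => zerof x + c * id01 x).
    by apply/funext => x; rewrite add0r.
  apply: (@null_content_shear _ _ _ _ _ `|c|) => //; first by lra.
  by move=> x y Ix Iy; rewrite !id01E // -mulrBr normrM.
(* The cost will be (2 + 2 r) (2 r) ^ (t - 1); this choice gives 2 r <= 1 and (2 r) ^ (t - 1) <= e /
   4. *)
move=> e e0; pose r := Num.min 1 ((e / 4) `^ (t - 1)^-1) / 2.
have r2 : 0 < 2 * r.
  by rewrite /r mulrC mulfVK // lt_min ltr01 powR_gt0 // divr_gt0.
have r0 : 0 < r by lra.
have r1 : 2 * r <= 1 by rewrite /r mulrC mulfVK // ge_min lexx.
have rt : (2 * r) `^ (t - 1) <= e / 4.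
  have t10 : 0 < t - 1 by lra.
  have -> : e / 4 = ((e / 4) `^ (t - 1)^-1) `^ (t - 1).
    by rewrite -powRrM mulVf ?gt_eqF // powRr1 // divr_ge0 // ltW.
  apply: ge0_ler_powR; rewrite ?nnegrE ?powR_ge0 ?(ltW t10) ?(ltW r2) //.
  by rewrite /r mulrC mulfVK // ge_min lexx orbT.
have := @content_le_curve t (fun u => (u, 0)) 1 r.
move=> /(_ _ ler01 r0 _ _)[] //; [lra|by move=> u v /=; rewrite subrr normr0|].
move=> C [C' CH]; apply: (content_leW _ _ (ex_intro _ C (ex_intro _ C' CH))).
  move=> [x y] [/= Ix ->]; exists x; first by move: Ix; rewrite /I01 /= in_itv.
  by split; rewrite /= subrr normr0 ltW.
have -> : (2 * r) `^ t = (2 * r) `^ (t - 1) * (2 * r).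
  by rewrite [RHS]mulrC mulr_powRB1 ?ltW //; lra.
have := powR_ge0 (2 * r) (t - 1); set A := _ `^ (t - 1) in rt * => A0.
have -> : (1 / r + 1) * (A * (2 * r)) = (2 + 2 * r) * A by field; rewrite gt_eqF.
by nra.
Qed.

Lemma Hs_shear s (f g : R -> R) L : 1 < s -> 0 <= L -> Hs s f -> C01 g ->
  (forall x y, I01 x -> I01 y -> `|g x - g y| <= L * `|x - y|) ->
  Hs s (fun x => f x + g x).
Proof.
move=> s1 L0 [Cf df] Cg gL; split; first exact: C01D.
apply: dimH_eq => // [t st|t t1 ts H].
  apply: null_content_shear L0 gL _; first by lra.
  exact: dimH_null_content df.
have t0 : 0 < t by lra.
exact: (dimH_lt t0 ts (null_content_shearK t0 L0 gL H)).
Qed.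

Lemma not_Hs_id01 s (c : R) : 1 < s -> ~ Hs s (fun x => c * id01 x).
Proof.
move=> s1 [_]; apply: (@dimH_lt _ _ ((1 + s) / 2)); [lra|lra|].
by apply: null_content_id01; lra.
Qed.

Lemma infinite_not_spaceable (TA TB : Type) (s : R) : 1 < s ->
  ([set: nat] #<= [set: TA])%card -> ~ spaceable TA TB (Hs s).
Proof.
move=> s1 natTA [[M [[sM [B [[BM [iB genB]] BTA]]] MH]] sp].
have MC : M `<=` @C01 R by case: sM.
have : ([set: nat] #<= B)%card by rewrite (card_le_eqr BTA).
move=> /pcard_leP/injfunPex[/= b bB binj].
have bI m n : b m = b n -> m = n by apply: binj; rewrite in_setT.
(* The pair holds the scaling of [f] and the multiple of [id01] to be added. Along the sequence [b]
   the scaled vectors tend to 0 and the multiple is 1; for other vectors only a positive scaling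
   matters. *)
have /choice[ec ecP] : forall f, exists ec : R * R, 0 < ec.1 /\
    forall n, b n = f -> ec.2 = 1 /\ forall x, `|ec.1 * f x| <= n.+1%:R^-1.
  move=> f; have [[n bn]|N] := pselect (exists n, b n = f); last first.
    by exists (1, 0); split => //= n bn; case: N; exists n.
  have [m m0 fm] : exists2 m, 0 <= m & forall x, `|f x| <= m.
    by apply: C01_bounded; apply: MC; apply: BM; rewrite -bn; exact: bB.
  exists ((m + 1)^-1 * n.+1%:R^-1, 1) => /=.
  have m10 : 0 < m + 1 by lra.
  split; first by rewrite mulr_gt0 // invr_gt0.
  move=> k bk; have -> : k = n by apply: bI; rewrite bk bn.
  split => // x; rewrite !normrM !normfV !normr_nat (gtr0_norm m10).
  rewrite mulrAC ler_piMl // ?invr_ge0 // mulrC ler_pdivrMr // mul1r.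
  by apply: le_trans (fm x) _; lra.
pose T (f : R -> R) := fun x => (ec f).1 * f x + (ec f).2 * id01 x.
have comb n (c : 'I_n -> R) (v : 'I_n -> R -> R) : lincomb c (T \o v) =
    (fun x => lincomb (fun i => c i * (ec (v i)).1) v x +
       (\sum_i c i * (ec (v i)).2) * id01 x).
  apply/funext => x; rewrite /lincomb mulr_suml -big_split /=; apply: eq_bigr => i _.
  by rewrite /T mulrDr !mulrA.
have indT n (c : 'I_n -> R) v : injective v -> (forall i, B (v i)) ->
    lincomb (fun i => c i * (ec (v i)).1) v = @zerof R -> forall i, c i = 0.
  move=> vinj vB /iB H i; have := H vinj vB i => /eqP; rewrite mulf_eq0.
  by have [/gt_eqF -> _] := ecP (v i); rewrite orbF => /eqP.
(* If a transformed combination vanishes, its part in [M] is a multiple of [id01]. Such a function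
   is never in [Hs s], so the part in [M] is 0 and the independence of [B] applies. *)
have lcM n (c : 'I_n -> R) v : (forall i, B (v i)) -> M (lincomb c v).
  by move=> vB; apply: subspace_lincomb => // i; exact: BM.
have indT' n (c : 'I_n -> R) v : injective v -> (forall i, B (v i)) ->
    lincomb c (T \o v) = @zerof R -> forall i, c i = 0.
  move=> vinj vB; rewrite comb => H.
  apply: (indT n c v vinj vB).
  have [hs|//] := MH _ (lcM n (fun i => c i * (ec (v i)).1) v vB).
  exfalso; apply: (@not_Hs_id01 s (- \sum_i c i * (ec (v i)).2) s1).
  suff <- : lincomb (fun i => c i * (ec (v i)).1) v =
     (fun x => - (\sum_i c i * (ec (v i)).2) * id01 x) by [].
  apply/funext => x; apply/eqP; rewrite mulNr -addr_eq0; apply/eqP.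
  by have := congr1 (fun f => f x) H.
have Tinj : {in B &, injective T}.
  move=> f g; rewrite !inE => Bf Bg fg; apply: contrapT => nfg.
  pose v (i : 'I_2) := if i == ord0 then f else g.
  have := @indT' 2 (fun i => if i == ord0 then 1 else -1) v.
  move=> /(_ _ _ _ ord0) H; suff : (1 : R) = 0 by move/eqP; rewrite oner_eq0.
  apply: H.
  - move=> [[|[|i]] hi] [[|[|j]] hj] //; rewrite /v -!val_eqE /= => E.
    + exact: val_inj.
    + by case: nfg; rewrite E.
    + exact: val_inj.
  - by move=> i; rewrite /v; case: ifP.
  - apply/funext => x; rewrite /lincomb !big_ord_recl big_ord0 /= /v /= fg.
    by rewrite mul1r mulN1r addr0 subrr.
(* The whole basis is transformed, not just the sequence, so that the new span has dimension [TA]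
   again. *)
pose W := lspan (T @` B).
have TBC : T @` B `<=` @C01 R.
  move=> _ [f Bf <-]; apply: C01D; apply: C01Z; last exact: C01_id01.
  by apply: MC; exact: BM.
have pre n (v : 'I_n -> R -> R) : (forall i, (T @` B) (v i)) ->
    exists2 w : 'I_n -> R -> R, (forall i, B (w i)) & v = T \o w.
  move=> vB; have /choice[w wP] : forall i, exists w, B w /\ T w = v i.
    by move=> i; have [w ? ?] := vB i; exists w.
  by exists w => [i|]; [have [] := wP i|apply/funext => i /=; have [_ ->] := wP i].
have dW : has_dim TA W.
  apply: has_dim_lspan => //.
    move=> n c v vinj /pre[w wB vE] cv0; apply: (indT' n c w) => //; last by rewrite -vE.
    by move=> i j wij; apply: vinj; rewrite vE /= wij.
  by apply: card_eq_trans BTA; exact: inj_card_eq.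
have WH : W `<=` Hs s `|` [set @zerof R].
  move=> _ [n [c [v [vB ->]]]]; have [m [d [w [winj wB ->]]]] := lincomb_inj c vB.
  have [u uB wE] := pre _ _ wB.
  have uinj : injective u by move=> i j uij; apply: winj; rewrite wE /= uij.
  rewrite wE comb.
  have [hs|/= z] := MH _ (lcM m (fun i => d i * (ec (u i)).1) u uB); last first.
    right => /=; have d0 := indT _ _ _ uinj uB z.
    rewrite -comb; apply/funext => x; rewrite /lincomb big1 // => i _.
    by rewrite d0 mul0r.
  left; set k := \sum_(i < m) _.
  apply: (Hs_shear s1 (normr_ge0 k) hs); first exact/C01Z/C01_id01.
  by move=> x y Ix Iy; rewrite !id01E // -mulrBr normrM.
have [V [[sV _] [clV [WV VH]]]] := sp W dW WH.
have : V id01.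
  apply: clV; first exact: C01_id01.
  move=> e e0; have [n ne] : exists n : nat, n.+1%:R^-1 < e.
    by have := ltr_add_invr e0; rewrite ?add0r => -[n]; rewrite add0r; exists n.
  exists (T (b n)); split; first by apply: WV; apply: sub_lspan; exists (b n) => //; exact: bB.
  apply: le_lt_trans ne; apply: supnorm_le => x.
  by have [_ /(_ n erefl)[e1 H]] := ecP (b n); rewrite /T e1 mul1r addrK.
move=> /VH[hs|/= id0].
  apply: (@not_Hs_id01 s 1 s1).
  by rewrite (_ : (fun x => 1 * id01 x) = id01) //; apply/funext => x; rewrite mul1r.
have : id01 1 = 0 by rewrite id0.
by rewrite /id01 ler01 lexx => /eqP; rewrite oner_eq0.
Qed.

End InfiniteDimensional.

(** * Rough functions on a Cantor set *)

Section WeierstrassTest.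
Variable R : realType.

Lemma weierstrass_test (f : nat -> R -> R) (K r : R) : 0 <= K -> 0 <= r -> r < 1 ->
  (forall k x, `|f k x| <= K * r ^+ k) ->
  exists g : R -> R, (forall N x, `|g x - \sum_(k < N) f k x| <= K * r ^+ N / (1 - r)) /\
    ((forall k, continuous (f k)) -> continuous g).
Proof.
move=> K0 r0 r1 fK.
have r10 : 0 < 1 - r by lra.
pose S x (n : nat) := \sum_(k < n) f k x.
have tail x N M : `|S x (N + M)%N - S x N| <= K * r ^+ N / (1 - r) * (1 - r ^+ M).
  elim: M => [|M IH]; first by rewrite addn0 subrr normr0 expr0 subrr mulr0.
  rewrite addnS /S big_ord_recr /= -/(S x (N + M)%N) -/(S x N) addrAC.
  apply: le_trans (ler_normD _ _) _; apply: le_trans (lerD IH (fK _ _)) _.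
  rewrite le_eqVlt; apply/orP; left; apply/eqP; rewrite exprD exprS.
  by field; rewrite gt_eqF.
have tail' x N M : (N <= M)%N -> `|S x M - S x N| <= K * r ^+ N / (1 - r).
  move=> NM; rewrite -(subnKC NM); apply: le_trans (tail _ _ _) _.
  rewrite ler_piMr ?divr_ge0 ?mulr_ge0 ?exprn_ge0 ?(ltW r10) //.
  by rewrite gerBl exprn_ge0.
have geo : (fun N => K * r ^+ N / (1 - r)) @ \oo --> (0 : R).
  rewrite -[X in _ --> X](mul0r (1 - r)^-1) -(mulr0 K).
  apply: cvgM; last exact: cvg_cst.
  apply: cvgM; first exact: cvg_cst.
  by apply: cvg_expr; rewrite ger0_norm.
have cS x : cvgn (S x).
  have -> : S x = series (f ^~ x).
    by rewrite seriesEord; apply/funext => n.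
  apply: normed_cvg; apply: (@series_le_cvg _ _ (geometric K r)) => [n|n|n|].
  - exact: normr_ge0.
  - by rewrite /geometric /= mulr_ge0 // exprn_ge0.
  - exact: fK.
  - by apply: is_cvg_geometric_series; rewrite ger0_norm.
have gtail N x : `|limn (S x) - S x N| <= K * r ^+ N / (1 - r).
  have h : (fun M => `|S x M - S x N|) @ \oo --> `|limn (S x) - S x N|.
    by apply: cvg_norm; apply: cvgB; [exact: cS|exact: cvg_cst].
  rewrite -(cvg_lim _ h) //; apply: limr_le; first by apply/cvg_ex; exists (`|limn (S x) - S x N|).
  by exists N => // M /= NM; exact: tail'.
exists (fun x => limn (S x)); split; first by move=> N x; exact: gtail.
move=> cf x; apply/cvgrPdist_le => e e0.
have e30 : 0 < e / 3 by rewrite divr_gt0.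
have /cvgrPdist_le/(_ _ e30)[N _ /(_ N (leqnn N))] := geo.
rewrite sub0r normrN ger0_norm; last by rewrite divr_ge0 ?mulr_ge0 ?exprn_ge0 ?(ltW r10).
move=> Ne.
have cSN : continuous (fun y => S y N).
  rewrite /S; elim: (N) => [|n IH] y.
    by under eq_fun do rewrite big_ord0; exact: cvg_cst.
  by under eq_fun do rewrite big_ord_recr /=; apply: cvgD; [exact: IH|exact: cf].
have /cvgrPdist_le/(_ _ e30) := cSN x.
apply: filterS => y xy.
have h1 := gtail N x; have h2 := gtail N y.
rewrite (_ : _ - _ = (limn (S x) - S x N) + (S x N - S y N) - (limn (S y) - S y N)); last by ring.
apply: le_trans (ler_normB _ _) _; have := ler_normD (limn (S x) - S x N) (S x N - S y N).
by move: xy; lra.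
Qed.

(** Functions built as limits are known only through their tail estimates; an exact identity between
    their values is obtained by bounding its defect by every tail. *)
Lemma eq0_geometric (a C r : R) N0 : 0 <= r -> r < 1 ->
  (forall N, (N0 <= N)%N -> `|a| <= C * r ^+ N) -> a = 0.
Proof.
move=> r0 r1 aC; apply/eqP/negPn/negP => a0.
have na : 0 < `|a| by rewrite normr_gt0.
have h0 : (fun N => C * r ^+ N) @ \oo --> (0 : R).
  rewrite -[X in _ --> X](mulr0 C); apply: cvgM; first exact: cvg_cst.
  by apply: cvg_expr; rewrite ger0_norm.
have /cvgrPdist_lt/(_ _ na)[N _ /(_ (maxn N N0) (leq_maxl _ _))] := h0.
rewrite sub0r normrN => lt1; have := aC _ (leq_maxr N N0).
by have := ler_norm (C * r ^+ maxn N N0); lra.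
Qed.

Lemma lipschitz_continuous (f : R -> R) C :
  (forall x y, `|f x - f y| <= C * `|x - y|) -> continuous f.
Proof.
move=> fC x; apply/cvgrPdist_lt => e e0.
have C0 : 0 < `|C| + 1 by rewrite ltr_wpDl.
apply/nbhs_ballP; exists (e / (`|C| + 1)); first exact: divr_gt0.
move=> y; rewrite /ball /= => xy; apply: le_lt_trans (fC x y) _.
by move: xy; rewrite ltr_pdivlMr // => xy; have := ler_norm C; have := normr_ge0 (x - y); nra.
Qed.

End WeierstrassTest.

(** * A Cantor scheme, its bump functions and the digit waves *)

Section CantorScheme.
Variables (R : realType) (lam : R).
Hypothesis lam_gt0 : 0 < lam.
Hypothesis lam_le : lam <= 2^-1.
Implicit Types (u v : nat -> bool) (n m i : nat) (x y : R).

(** For [lam] equal to 1/2, intervals of length lam ^ n would leave no gaps. The divisor n + 3 makes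
    room for gaps of size [gam n] and changes all sizes by polynomial factors only. *)
Definition len n : R := lam ^+ n / n.+3%:R.
Definition gam n : R := lam ^+ n / n.+4%:R ^+ 2.

Lemma len_gt0 n : 0 < len n. Proof. by rewrite divr_gt0 // exprn_gt0. Qed.
Lemma gam_gt0 n : 0 < gam n. Proof. by rewrite divr_gt0 ?exprn_gt0. Qed.

(** The worst case is lam = 1/2, where the claim is 1 / (k + 1) + 1 / (k + 1) ^ 2 <= 1 / k with k =
    n + 3. *)
Lemma len_gap n : 2 * len n.+1 + gam n <= len n.
Proof.
rewrite /len /gam exprS; set a := lam ^+ n; set k : R := n.+3%:R.
have a0 : 0 < a by rewrite exprn_gt0.
have k0 : 0 < k by rewrite ltr0n.
have -> : n.+4%:R = k + 1 :> R by rewrite /k -[in LHS]addn1 natrD.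
have k1 : 0 < k + 1 by lra.
have h : 2 * (lam * a / (k + 1)) <= a / (k + 1).
  have a1 : 0 <= a / (k + 1) by rewrite divr_ge0 // ltW.
  rewrite (_ : 2 * _ = 2 * lam * (a / (k + 1))); last by ring.
  by rewrite ler_piMl //; move: lam_le; lra.
apply: (@le_trans _ _ (a / (k + 1) + a / (k + 1) ^+ 2)); first by rewrite lerD2r.
rewrite -mulrDr ler_wpM2l ?(ltW a0) //.
rewrite -subr_ge0 (_ : _ - _ = (k * (k + 1) ^+ 2)^-1); last by field; rewrite !gt_eqF.
by rewrite invr_ge0 mulr_ge0 ?exprn_ge0 // ltW.
Qed.

Lemma len_leS n : len n.+1 <= len n.
Proof. by have := len_gap n; have := gam_gt0 n; have := len_gt0 n.+1; lra. Qed.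

Lemma lam_lt1 : lam < 1. Proof. by move: lam_le; lra. Qed.

Lemma gam_le n m : (n <= m)%N -> gam m <= gam n.
Proof.
move=> nm; rewrite /gam; apply: ler_pM; rewrite ?invr_ge0 ?exprn_ge0 ?(ltW lam_gt0) //.
  by rewrite ler_wiXn2l // ltW // lam_lt1.
rewrite lef_pV2 ?posrE ?exprn_gt0 // lerXn2r ?nnegrE // ler_nat.
by rewrite !ltnS.
Qed.

Lemma gam_le16 n : gam n <= 16^-1.
Proof.
apply: le_trans (gam_le (leq0n n)) _; rewrite /gam expr0 div1r -natrX.
by rewrite lef_pV2 ?posrE // ler_nat.
Qed.

Lemma gam_le_len n : gam n <= len n.
Proof. by have := len_gap n; have := len_gt0 n.+1; lra. Qed.

Lemma len_le_inv n : len n <= n.+3%:R^-1.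
Proof. by rewrite /len ler_piMl ?invr_ge0 // exprn_ile1 // ltW // lam_lt1. Qed.

Lemma len_le_pow n : len n <= lam ^+ n.
Proof. by rewrite /len ler_piMr ?exprn_ge0 ?(ltW lam_gt0) // invf_le1 // ler1n. Qed.

(** Left end of the level-n interval coded by [u]: a true digit selects the right child, which
    shares the right end of its parent. *)
Definition pos n u : R :=
  3^-1 + \sum_(i < n) (if u i then len i - len i.+1 else 0).

Lemma posS n u : pos n.+1 u = pos n u + (if u n then len n - len n.+1 else 0).
Proof. by rewrite /pos big_ord_recr /= addrA. Qed.

Lemma eq_pos n u v : (forall i, (i < n)%N -> u i = v i) -> pos n u = pos n v.
Proof. by move=> uv; congr (_ + _); apply: eq_bigr => i _; rewrite uv. Qed.

Lemma pos_stable n m u : (n <= m)%N -> (forall i, (n <= i)%N -> u i = false) ->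
  pos m u = pos n u.
Proof.
move=> nm u0; elim: m nm => [|m IH]; first by rewrite leqn0 => /eqP ->.
rewrite leq_eqVlt => /orP[/eqP -> //|]; rewrite ltnS => nm.
by rewrite posS u0 // addr0 IH.
Qed.

Lemma pos_nested n m u : (n <= m)%N ->
  pos n u <= pos m u /\ pos m u + len m <= pos n u + len n.
Proof.
elim: m => [|m IH]; first by rewrite leqn0 => /eqP ->.
rewrite leq_eqVlt => /orP[/eqP -> //|]; rewrite ltnS => /IH[h1 h2].
by rewrite posS; have := len_leS m; case: ifP => _; split; lra.
Qed.

Lemma pos_itv n u : 3^-1 <= pos n u /\ pos n u + len n <= 2 / 3.
Proof.
have [] := pos_nested u (leq0n n).
have -> : len 0 = 3^-1 by rewrite /len expr0 div1r.
by rewrite /pos big_ord0; split; lra.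
Qed.

(** At level i + 1 the words lie in opposite children of one interval, at least [gam i] apart, and
    deeper intervals stay inside these children. *)
Lemma pos_sep i n m u v : (forall j, (j < i)%N -> u j = v j) ->
  u i = false -> v i = true -> (i < n)%N -> (i < m)%N ->
  pos n u + len n + gam i <= pos m v.
Proof.
move=> uv ui vi lin lim.
have [_] := pos_nested u lin; have [+ _] := pos_nested v lim.
by rewrite !posS ui vi (eq_pos uv); have := len_gap i; lra.
Qed.

Lemma first_difference (n : nat) u v : (exists2 j, (j < n)%N & u j <> v j) ->
  exists i, [/\ (i < n)%N, forall j, (j < i)%N -> u j = v j & u i <> v i].
Proof.
move=> [j jn /eqP uvj]; have ex : exists j, (u j != v j) by exists j.
case: (ex_minnP ex) => i uvi imin; exists i; split.
- exact: leq_ltn_trans (imin j uvj) jn.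
- by move=> k ki; apply/eqP/negPn/negP => /imin; rewrite leqNgt ki.
- exact/eqP.
Qed.

Lemma pos_agree k n m u v : (k < n)%N -> (k < m)%N ->
  `|pos n u - pos m v| < gam k -> forall i, (i <= k)%N -> u i = v i.
Proof.
move=> kn km d i ik; apply: contrapT => uvi.
have [j [jk uvj dj]] := @first_difference k.+1 u v (ex_intro2 _ _ i ik uvi).
have jk' : (j <= k)%N by [].
have jn := leq_ltn_trans jk' kn; have jm := leq_ltn_trans jk' km.
have gjk := gam_le jk'; have l1 := len_gt0 n; have l2 := len_gt0 m.
move: d; rewrite ltr_norml => /andP[d1 d2].
case uj : (u j); case vj : (v j) => //; rewrite ?uj ?vj // in dj.
  have := @pos_sep j m n v u (fun l lj => esym (uvj l lj)) vj uj jm jn; lra.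
have := @pos_sep j n m u v uvj uj vj jn jm; lra.
Qed.

(** A trapezoid: 1 on the level-n interval, 0 from distance gam n / 3 on. The margins of two
    neighbours add up to at most two thirds of their gap, so the bumps of incompatible words are
    disjoint. *)
Definition plateau n u x : R :=
  Num.max 0 (Num.min 1 (1 + (len n / 2 - `|x - (pos n u + len n / 2)|) / (gam n / 3))).

Lemma plateau_ge0 n u x : 0 <= plateau n u x. Proof. by rewrite le_max lexx. Qed.

Lemma plateau_le1 n u x : plateau n u x <= 1.
Proof. by rewrite ge_max ler01 ge_min lexx. Qed.

Lemma eq_plateau n u v : (forall i, (i < n)%N -> u i = v i) -> plateau n u = plateau n v.
Proof. by move=> uv; rewrite /plateau (eq_pos uv). Qed.

Lemma plateau1 n u x : pos n u <= x -> x <= pos n u + len n -> plateau n u x = 1.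
Proof.
move=> x1 x2; rewrite /plateau min_l; first by rewrite max_r // ler01.
rewrite lerDl; apply: divr_ge0; last by rewrite divr_ge0 // ltW // gam_gt0.
by rewrite subr_ge0 ler_norml; apply/andP; split; lra.
Qed.

Lemma plateau_support n u x : plateau n u x != 0 ->
  pos n u - gam n / 3 < x /\ x < pos n u + len n + gam n / 3.
Proof.
have g0 := gam_gt0 n; move=> b0.
have g30 : 0 < gam n / 3 by rewrite divr_gt0.
have : 0 < 1 + (len n / 2 - `|x - (pos n u + len n / 2)|) / (gam n / 3).
  rewrite ltNge; apply: contra b0 => h; rewrite /plateau max_l //.
  by rewrite ge_min h orbT.
rewrite -(@pmulr_rgt0 _ (gam n / 3)) //.
rewrite mulrDr mulr1 [_ * (_ / _)]mulrCA divff ?gt_eqF // mulr1 => h.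
have : `|x - (pos n u + len n / 2)| < gam n / 3 + len n / 2 by lra.
by rewrite ltr_norml => /andP[]; split; lra.
Qed.

Lemma plateau_lipschitz n u x y :
  `|plateau n u x - plateau n u y| <= 3 / gam n * `|x - y|.
Proof.
have mx (a b : R) : `|Num.max 0 (Num.min 1 a) - Num.max 0 (Num.min 1 b)| <= `|a - b|.
  have cl (c : R) : [\/ c <= 0 /\ Num.max 0 (Num.min 1 c) = 0,
      1 <= c /\ Num.max 0 (Num.min 1 c) = 1
    | 0 <= c <= 1 /\ Num.max 0 (Num.min 1 c) = c].
    have [c1|c1] := leP 1 c; first by apply: Or32; rewrite max_r.
    have [c0|c0] := leP c 0; first by apply: Or31.
    by apply: Or33; rewrite !ltW.
  have h1 := ler_norm (a - b); have := ler_norm (b - a); rewrite distrC => h2.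
  have h0 := normr_ge0 (a - b).
  by case: (cl a) => -[ha ->]; case: (cl b) => -[hb ->]; rewrite ler_norml; lra.
apply: le_trans (mx _ _) _; set z := pos n u + len n / 2.
rewrite (_ : _ - _ = 3 / gam n * (`|y - z| - `|x - z|)); last first.
  by field; rewrite gt_eqF // gam_gt0.
have c0 : 0 <= 3 / gam n by rewrite divr_ge0 // ltW // gam_gt0.
rewrite normrM ger0_norm // ler_wpM2l //.
apply: le_trans (ler_dist_dist _ _) _; rewrite distrC.
by rewrite (_ : x - z - (y - z) = x - y) //; ring.
Qed.

Lemma plateau_disjoint n m u v x : (exists2 i, (i < n)%N && (i < m)%N & u i <> v i) ->
  plateau n u x != 0 -> plateau m v x = 0.
Proof.
move=> [i /andP[lin lim] uvi] /plateau_support[h1 h2].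
apply/eqP/negPn/negP => /plateau_support[h3 h4].
have ex : exists2 j, (j < minn n m)%N & u j <> v j by exists i => //; rewrite leq_min lin.
have [j [+ uvj dj]] := first_difference ex; rewrite leq_min => /andP[jn jm].
have g1 := gam_le (ltnW jn); have g2 := gam_le (ltnW jm); have g0 := gam_gt0 j.
case uj : (u j); case vj : (v j) => //; rewrite ?uj ?vj // in dj.
  have := @pos_sep j m n v u (fun l lj => esym (uvj l lj)) vj uj jm jn; lra.
have := @pos_sep j n m u v uvj uj vj jn jm; lra.
Qed.

Lemma plateau_itv n u x : plateau n u x != 0 -> 4^-1 < x /\ x < 3 / 4.
Proof.
move=> /plateau_support[h1 h2]; have [h3 h4] := pos_itv n u; have := gam_le16 n.
by split; lra.
Qed.

(** Padding by false digits picks the left end of the interval, a point at which [pos] is the same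
    for all levels from n on. *)
Definition ext n (f : {ffun 'I_n -> bool}) i : bool :=
  if insub i is Some j then f j else false.

Lemma ext_ord n (f : {ffun 'I_n -> bool}) (i : 'I_n) : ext f i = f i.
Proof. by rewrite /ext valK. Qed.

Lemma ext_ge n (f : {ffun 'I_n -> bool}) i : (n <= i)%N -> ext f i = false.
Proof. by move=> ni; rewrite /ext insubF // ltnNge ni. Qed.

Lemma ext_finfun n u i : (i < n)%N -> ext [ffun j : 'I_n => u j] i = u i.
Proof. by move=> lin; rewrite -[i in LHS]/(val (Ordinal lin)) ext_ord ffunE. Qed.

Lemma ext_inj n (f g : {ffun 'I_n -> bool}) :
  (forall i, (i < n)%N -> ext f i = ext g i) -> f = g.
Proof. by move=> fg; apply/ffunP => i; rewrite -!ext_ord fg. Qed.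

Lemma binary_lt (u : nat -> bool) l : (\sum_(i < l) u i * 2 ^ i < 2 ^ l)%N.
Proof.
elim: l => [|l IH]; first by rewrite big_ord0.
rewrite big_ord_recr /= expnS mul2n -addnn; apply: (leq_trans (n := 2 ^ l + u l * 2 ^ l)).
  by rewrite ltn_add2r.
by rewrite leq_add2l; case: (u l); rewrite ?mul1n ?mul0n.
Qed.

Lemma binary_inj u v l : (\sum_(i < l) u i * 2 ^ i = \sum_(i < l) v i * 2 ^ i)%N ->
  forall i, (i < l)%N -> u i = v i.
Proof.
elim: l => // l IH; rewrite !big_ord_recr /=.
have := binary_lt u l; have := binary_lt v l.
set a := (\sum_(i < l) _)%N in IH *; set b := (\sum_(i < l) _)%N in IH *.
case ul : (u l); case vl : (v l); rewrite ?mul1n ?mul0n ?addn0 => bl al ab.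
- move=> i; rewrite ltnS leq_eqVlt => /orP[/eqP ->|il]; first by rewrite ul vl.
  by apply: IH => //; move/eqP: ab; rewrite eqn_add2r => /eqP.
- by move: bl; rewrite -ab ltnNge leq_addl.
- by move: al; rewrite ab ltnNge leq_addl.
- by move=> i; rewrite ltnS leq_eqVlt => /orP[/eqP ->|il]; [rewrite ul vl|exact: IH].
Qed.

(* The binary digits of a point of the Cantor set are cut into blocks
   [p k, p k + L k), and [digits k] reads the k-th block as a number. *)
Variables p L : nat -> nat.
Definition block_end k := (p k + L k)%N.
Definition digits k u : nat := (\sum_(i < L k) u (p k + i) * 2 ^ i)%N.
(** On the Cantor set this is the fraction spelled by the k-th block, first digit least significant;
    the bumps extend it to a Lipschitz function on the line. *)
Definition wave k x : R := \sum_(f : {ffun 'I_(block_end k) -> bool})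
  (digits k (ext f))%:R / 2 ^+ L k * plateau (block_end k) (ext f) x.

Lemma digits_ext k u v : (forall i, (p k <= i < block_end k)%N -> u i = v i) ->
  digits k u = digits k v.
Proof.
move=> uv; apply: eq_bigr => i _; rewrite uv // leq_addr /=.
by rewrite /block_end ltn_add2l.
Qed.

Lemma digits_itv k u : 0 <= ((digits k u)%:R / 2 ^+ L k : R) <= 1.
Proof.
rewrite divr_ge0 ?exprn_ge0 //= ler_pdivrMr ?exprn_gt0 // mul1r -natrX ler_nat ltnW //.
exact: binary_lt (fun i => u (p k + i)%N) (L k).
Qed.

Lemma wave_single k (f : {ffun 'I_(block_end k) -> bool}) x : plateau (block_end k) (ext f) x != 0 ->
  wave k x = (digits k (ext f))%:R / 2 ^+ L k * plateau (block_end k) (ext f) x.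
Proof.
move=> bf; rewrite /wave (bigD1 f) //= big1 ?addr0 // => g gf.
suff -> : plateau (block_end k) (ext g) x = 0 by rewrite mulr0.
apply: plateau_disjoint bf; apply: contrapT => N.
have fg : f = g.
  apply: ext_inj => i iq; apply: contrapT => ne; apply: N; exists i => //.
  by rewrite iq.
by rewrite fg eqxx in gf.
Qed.

Lemma wave_at k u x : pos (block_end k) u <= x -> x <= pos (block_end k) u + len (block_end k) ->
  wave k x = (digits k u)%:R / 2 ^+ L k.
Proof.
move=> x1 x2; pose f := [ffun i : 'I_(block_end k) => u i].
have uf i : (i < block_end k)%N -> ext f i = u i by exact: ext_finfun.
have b1 : plateau (block_end k) (ext f) x = 1 by apply: plateau1; rewrite (eq_pos uf).
rewrite (@wave_single _ f) b1 ?oner_neq0 // mulr1.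
by rewrite (@digits_ext _ (ext f) u) // => i /andP[_]; exact: uf.
Qed.

Lemma wave_cases k x : wave k x = 0 \/
  exists f : {ffun 'I_(block_end k) -> bool}, plateau (block_end k) (ext f) x != 0.
Proof.
have [|N] := pselect (exists f : {ffun 'I_(block_end k) -> bool}, plateau (block_end k) (ext f) x != 0).
  by right.
left; rewrite /wave big1 // => f _.
have [->|nz] := eqVneq (plateau (block_end k) (ext f) x) 0; first by rewrite mulr0.
by case: N; exists f.
Qed.

Lemma wave_itv k x : 0 <= wave k x <= 1.
Proof.
have [->|[f bf]] := wave_cases k x; first by rewrite lexx ler01.
rewrite (wave_single bf); have /andP[d0 d1] := digits_itv k (ext f).
have b0 := plateau_ge0 (block_end k) (ext f) x; have b1 := plateau_le1 (block_end k) (ext f) x.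
by rewrite mulr_ge0 //= mulr_ile1.
Qed.

Lemma lipschitz_sum (I : finType) (F : I -> R -> R) (C : I -> R) :
  (forall (k : I) x y, `|F k x - F k y| <= C k * `|x - y|) ->
  forall x y, `|\sum_(k : I) F k x - \sum_(k : I) F k y| <= (\sum_(k : I) C k) * `|x - y|.
Proof.
move=> FC x y; rewrite -sumrB; apply: (le_trans (ler_norm_sum _ _ _)).
by rewrite mulr_suml; apply: ler_sum => k _.
Qed.

Lemma wave_lipschitz k : exists C, forall x y, `|wave k x - wave k y| <= C * `|x - y|.
Proof.
exists (\sum_(f : {ffun 'I_(block_end k) -> bool}) 3 / gam (block_end k)).
apply: lipschitz_sum => f x y; rewrite -mulrBr normrM.
have /andP[d0 d1] := digits_itv k (ext f).
rewrite (ger0_norm d0); apply: le_trans (plateau_lipschitz (block_end k) (ext f) x y).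
by rewrite ler_piMl.
Qed.

Lemma wave_partial_lipschitz m : exists C,
  forall x y, `|\sum_(k < m) 2^-1 ^+ k * wave k x - \sum_(k < m) 2^-1 ^+ k * wave k y| <= C * `|x - y|.
Proof.
have /choice[C CP] := wave_lipschitz.
exists (\sum_(k < m) 2^-1 ^+ k * C k); apply: lipschitz_sum => k x y.
by rewrite -mulrBr normrM ger0_norm ?exprn_ge0 // -mulrA ler_wpM2l ?exprn_ge0.
Qed.

Variable h : R -> R.
Hypothesis h_tail : forall N x,
  `|h x - \sum_(k < N) 2^-1 ^+ k * wave k x| <= 2 * 2^-1 ^+ N.

Lemma h_finite N x : (forall k, (N <= k)%N -> wave k x = 0) ->
  h x = \sum_(k < N) 2^-1 ^+ k * wave k x.
Proof.
move=> w0; apply/eqP; rewrite -subr_eq0; apply/eqP.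
apply: (@eq0_geometric _ _ 2 2^-1 N) => [||M NM]; [by []|lra|].
have -> : \sum_(k < N) 2^-1 ^+ k * wave k x = \sum_(k < M) 2^-1 ^+ k * wave k x.
  elim: M NM => [|M IH]; first by rewrite leqn0 => /eqP ->.
  rewrite leq_eqVlt => /orP[/eqP -> //|]; rewrite ltnS => NM.
  by rewrite big_ord_recr /= w0 // mulr0 addr0 IH.
exact: h_tail.
Qed.

(** Isolates the only wave that distinguishes two points, which later turns closeness of values of
    [h] into closeness of digit blocks. *)
Lemma h_diff k x y : (forall j, j <> k -> wave j x = wave j y) ->
  h x - h y = 2^-1 ^+ k * (wave k x - wave k y).
Proof.
move=> wxy; apply/eqP; rewrite -subr_eq0; apply/eqP.
apply: (@eq0_geometric _ _ 4 2^-1 k.+1) => [||M kM]; [by []|lra|].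
have wE : \sum_(j < M) 2^-1 ^+ j * wave j x - \sum_(j < M) 2^-1 ^+ j * wave j y =
    2^-1 ^+ k * (wave k x - wave k y).
  have -> : forall A B : 'I_M -> R, \sum_j A j - \sum_j B j = \sum_j (A j - B j).
    by move=> A B; rewrite sumrB.
  rewrite (bigD1 (Ordinal kM)) //= [X in _ + X]big1 ?addr0 ?mulrBr // => j jk.
  rewrite wxy ?subrr // => jk'; move: jk; by rewrite -val_eqE /= jk' eqxx.
rewrite -wE.
rewrite (_ : _ - _ - _ = (h x - \sum_(j < M) 2^-1 ^+ j * wave j x) -
   (h y - \sum_(j < M) 2^-1 ^+ j * wave j y)); last by ring.
apply: le_trans (ler_normB _ _) _.
by have := h_tail M x; have := h_tail M y; lra.
Qed.

Lemma h_bound x : `|h x| <= 2.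
Proof. by have := h_tail 0 x; rewrite big_ord0 subr0 expr0 mulr1. Qed.

End CantorScheme.

(** * Perturbation by a rough function: dimension at most s *)

Section UpperBound.
Variables (R : realType) (lam s : R).
Hypothesis lam_gt0 : 0 < lam.
Hypothesis lam_le : lam <= 2^-1.
Hypothesis lam_s : lam `^ (s - 1) = 2^-1.
Variables p L : nat -> nat.
Hypothesis p_ge : forall k, (k <= p k)%N.
Variable h : R -> R.
Hypothesis h_tail : forall N x,
  `|h x - \sum_(k < N) 2^-1 ^+ k * wave lam p L k x| <= 2 * 2^-1 ^+ N.

Lemma powR_pow (t : R) n : (lam ^+ n) `^ t = (lam `^ t) ^+ n.
Proof.
by rewrite -powR_mulrn ?(ltW lam_gt0) // -powRrM mulrC powRrM powR_mulrn ?powR_ge0.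
Qed.

Lemma double_lam_pow (t : R) : 2 * lam `^ (t - 1) = lam `^ (t - s).
Proof.
have -> : t - s = (t - 1) - (s - 1) by ring.
rewrite powRB; last by rewrite (gt_eqF lam_gt0) implybT.
by rewrite lam_s invrK mulrC.
Qed.

Lemma powR_lt1 (e : R) : 0 < e -> lam `^ e < 1.
Proof.
move=> e0; suff : lam `^ e < 1 `^ e by rewrite powR1.
apply: gt0_ltr_powR => //; rewrite ?nnegrE ?(ltW lam_gt0) //.
by move: lam_le; lra.
Qed.

(** The support lies near 2 ^ Q intervals of length l, and above each of them a column of about M /
    l squares covers the graph. The total 2 ^ Q (M / l) l ^ t is of order (2 lam ^ (t - 1)) ^ Q,
    which decays geometrically for t > s by [double_lam_pow]. *)
Lemma content_le_wave_support (t M : R) (g : R -> R) k : s < t -> 1 < t -> 0 <= M ->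
  (forall x, `|g x| <= M) ->
  content_le t (graph g [set x | wave lam p L k x != 0])
    (2 * (2 * M + 1) * 4 `^ (t - 1) * (lam `^ (t - s)) ^+ k).
Proof.
move=> st t1 M0 gM; set Q := block_end p L k; set l := len lam Q.
have l0 : 0 < l by exact: len_gt0.
have t10 : 0 <= t - 1 by lra.
have K0 : 0 <= (2 * M / (2 * l) + 1) * (2 * (2 * l)) `^ t.
  by apply: mulr_ge0 (powR_ge0 _ _); apply: addr_ge0 => //; apply: divr_ge0; lra.
pose E (f : {ffun 'I_Q -> bool}) := [set z : R * R | exists2 u, 0 <= u <= 2 * M &
  square (pos lam Q (ext f), u - M) (2 * l) z].
apply: (@content_leW _ _ _ [set z | exists f, E f z]
   (#|{ffun 'I_Q -> bool}|%:R * ((2 * M / (2 * l) + 1) * (2 * (2 * l)) `^ t))).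
- move=> [x y] /= [/= wx ->]; have [w0|[f /(plateau_support lam_gt0)[x1 x2]]] := wave_cases lam p L k x.
    by rewrite w0 eqxx in wx.
  exists f, (g x + M); first by have := gM x; rewrite ler_norml; lra.
  have := gam_le_len lam_gt0 lam_le Q; rewrite -/Q -/l in x1 x2 * => gl.
  split => /=; last by rewrite addrK subrr normr0; lra.
  by rewrite ler_norml; apply/andP; split; lra.
- rewrite card_ffun card_bool card_ord natrX.
  have l23 : 2 * l <= 1.
    have := len_le_inv lam_gt0 lam_le Q; rewrite -/l => /le_trans h1.
    have : l <= 3^-1 by apply: h1; rewrite lef_pV2 ?posrE // ler_nat.
    by lra.
  have -> : (2 * (2 * l)) `^ t = (4 * l) `^ (t - 1) * (4 * l).
    by rewrite [RHS]mulrC mulr_powRB1; [congr (_ `^ _); ring|lra|lra].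
  apply: (@le_trans _ _ (2 ^+ Q * (2 * (2 * M + 1) * (4 * l) `^ (t - 1)))).
    rewrite ler_wpM2l ?exprn_ge0 // (mulrC (_ `^ _)) mulrA ler_wpM2r ?powR_ge0 //.
    rewrite (_ : _ * (4 * l) = 2 * (2 * M + 2 * l)); last by field; rewrite gt_eqF.
    by lra.
  have lQ : (4 * l) `^ (t - 1) <= 4 `^ (t - 1) * (lam `^ (t - 1)) ^+ Q.
    rewrite -powR_pow -powRM ?exprn_ge0 ?(ltW lam_gt0) //.
    apply: ge0_ler_powR; rewrite ?nnegrE ?mulr_ge0 ?exprn_ge0 ?(ltW lam_gt0) ?(ltW l0) //.
    by rewrite ler_wpM2l //; exact: (len_le_pow lam_gt0 Q).
  apply: (@le_trans _ _ (2 ^+ Q * (2 * (2 * M + 1) * (4 `^ (t - 1) * (lam `^ (t - 1)) ^+ Q)))).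
    rewrite ler_wpM2l ?exprn_ge0 // ler_wpM2l //; lra.
  rewrite (_ : 2 ^+ Q * _ = 2 * (2 * M + 1) * 4 `^ (t - 1) * (2 * lam `^ (t - 1)) ^+ Q); last first.
    by rewrite exprMn; ring.
  rewrite double_lam_pow ler_wpM2l //.
    by rewrite mulr_ge0 ?powR_ge0 // mulr_ge0 //; lra.
  apply: ler_wiXn2l; rewrite ?powR_ge0 //; first by apply: ltW; apply: powR_lt1; lra.
  by apply: leq_trans (p_ge k) _; rewrite leq_addr.
apply: content_le_fin => // [|f]; first by lra.
apply: content_le_curve; [lra|lra|lra| |].
  by move=> u v /=; rewrite subrr normr0.
by move=> u v /=; rewrite (_ : u - M - (v - M) = u - v) //; ring.
Qed.

(** Borel-Cantelli: the contents of the wave supports are dominated by a convergent geometric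
    series. *)
Lemma null_content_wave_limsup (t M : R) (g : R -> R) : s < t -> 1 < t -> 0 <= M ->
  (forall x, `|g x| <= M) ->
  null_content t (graph g [set x | forall m, exists2 k, (m <= k)%N & wave lam p L k x != 0]).
Proof.
move=> st t1 M0 gM e e0; set D := 2 * (2 * M + 1) * 4 `^ (t - 1).
have D0 : 0 <= D by rewrite mulr_ge0 ?powR_ge0 // mulr_ge0 //; lra.
set k1 := lam `^ (t - s).
have k0 : 0 <= k1 by exact: powR_ge0.
have k11 : k1 < 1 by apply: powR_lt1; lra.
have r10 : 0 < 1 - k1 by lra.
have Dk m : 0 <= D * k1 ^+ m / (1 - k1).
  by apply: divr_ge0 (ltW r10); apply: mulr_ge0 => //; exact: exprn_ge0.
have geo : (fun m => D * k1 ^+ m / (1 - k1)) @ \oo --> (0 : R).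
  rewrite -[X in _ --> X](mul0r (1 - k1)^-1) -(mulr0 D).
  apply: cvgM; last exact: cvg_cst.
  apply: cvgM; first exact: cvg_cst.
  by apply: cvg_expr; rewrite ger0_norm.
have /cvgrPdist_le/(_ _ e0)[m _ /(_ m (leqnn m))] := geo.
rewrite sub0r normrN ger0_norm //.
move=> me.
apply: (content_leW _ me) (content_le_bigcup (E := fun k => graph g [set x | wave lam p L (m + k) x != 0])
   (b := fun k => D * k1 ^+ (m + k)) _ _ _).
- move=> [x y] [/= /(_ m)[k mk wk] ->]; exists (k - m)%N => //; split => //=.
  by rewrite subnKC.
- by lra.
- by move=> n; exact: content_le_wave_support.
- move=> n; have -> : \sum_(i < n) D * k1 ^+ (m + i) = D * k1 ^+ m / (1 - k1) * (1 - k1 ^+ n).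
    elim: n => [|n IH]; first by rewrite big_ord0 expr0 subrr mulr0.
    by rewrite big_ord_recr /= IH exprD exprS; field; rewrite gt_eqF.
  rewrite ler_piMr //.
  by rewrite gerBl exprn_ge0.
Qed.

(* Off the small set where infinitely many waves are alive, [g - w] is Lipschitz
   on countably many pieces, so [g] inherits the dimension of [w] there. *)
Lemma null_content_perturbation (t M : R) (w g : R -> R) (phi : nat -> R -> R) (a : nat -> R) :
  s < t -> 1 < t -> 0 <= M -> (forall x, `|g x| <= M) ->
  null_content t (graph w (@I01 R)) ->
  (forall j x, `|phi j x| <= 1) ->
  (forall j, exists C, forall x y, `|phi j x - phi j y| <= C * `|x - y|) ->
  (forall x, (forall j, phi j x = 0) -> g x = w x) ->
  (forall j x, phi j x != 0 -> g x = w x + a j * (phi j x * h x)) ->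
  null_content t (graph g (@I01 R)).
Proof.
move=> st t1 M0 gM wN phi1 phiL g0 gphi.
have t0 : 0 < t by lra.
pose A j m := [set x | [/\ @I01 R x, phi j x != 0 & forall k, (m <= k)%N -> wave lam p L k x = 0]].
apply: (@null_contentW _ _ _ ((graph g [set x | forall m, exists2 k, (m <= k)%N & wave lam p L k x != 0]
   `|` graph w (@I01 R)) `|` \bigcup_j \bigcup_m graph g (A j m))).
  move=> [x y] [/= Ix ->].
  have [al|nal] := pselect (forall m, exists2 k, (m <= k)%N & wave lam p L k x != 0).
    by left; left.
  have [ph|nph] := pselect (forall j, phi j x = 0).
    by left; right; split => //=; exact: g0.
  have [j pj] : exists j, phi j x != 0.
    by apply: contrapT => N; apply: nph => j; apply/eqP/negPn/negP => pj; apply: N; exists j.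
  have [m pm] : exists m, forall k, (m <= k)%N -> wave lam p L k x = 0.
    apply: contrapT => N; apply: nal => m; apply: contrapT => N'; apply: N; exists m => k mk.
    by apply/eqP/negPn/negP => wk; apply: N'; exists k.
  by right; exists j => //; exists m.
apply: null_contentU => //.
  by apply: null_contentU => //; exact: null_content_wave_limsup M0 gM.
apply: null_content_bigcup => // j; apply: null_content_bigcup => // m.
have [C CP] := phiL j.
have [C' CP'] := wave_partial_lipschitz lam_gt0 p L m.
have E : graph g (A j m) = graph (fun x => w x + a j * (phi j x * h x)) (A j m).
  by apply/seteqP; split => -[x y] [/= [Ix pj wk] ->]; split => //=; rewrite (gphi j).
(* Product rule: [h] is bounded by 2 and [phi j] by 1, while [C] and [C'] are Lipschitz constants of
   [phi j] and of the m-th partial sum of [h]. *)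
rewrite E; apply: (@null_content_shear _ _ _ _ _ (`|a j| * (2 * `|C| + `|C'|))) => //.
- move=> x y [Ix px wx] [Iy py wy].
  rewrite -mulrBr normrM -mulrA ler_wpM2l //.
  rewrite (_ : _ - _ = (phi j x - phi j y) * h x + phi j y * (h x - h y)); last by ring.
  apply: (le_trans (ler_normD _ _)); rewrite !normrM mulrDl; apply: lerD.
    rewrite (mulrC 2) mulrAC; apply: ler_pM => //; last exact: h_bound h_tail x.
    by apply: le_trans (CP x y) _; rewrite ler_wpM2r // ler_norm.
  apply: (@le_trans _ _ (1 * `|h x - h y|)); first by rewrite ler_wpM2r.
  rewrite mul1r (h_finite h_tail wx) (h_finite h_tail wy).
  by apply: le_trans (CP' x y) _; rewrite ler_wpM2r // ler_norm.
- apply: null_contentW wN => -[x y] [/= [Ix _ _] ->]; by [].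
Qed.

End UpperBound.

(** * Perturbation by a rough function: dimension at least s *)

Lemma split_length (m b c n : nat) : (m <= b)%N -> (b + c <= n)%N ->
  (n = b - m + (n - (b + c)) + c + m)%N.
Proof. lia. Qed.

Section LowerBound.
Variables (R : realType) (lam s : R).
Hypothesis lam_gt0 : 0 < lam.
Hypothesis lam_le : lam <= 2^-1.
Hypothesis lam_s : lam `^ (s - 1) = 2^-1.
Hypothesis s_le2 : s <= 2.
Variables p L : nat -> nat.
Hypothesis block_sep : forall k, (block_end p L k <= p k.+1)%N.
Hypothesis p_ge : forall k, (k.+1 ^ 2 <= p k)%N.

(** The smallest half-side entrusted to the k-th wave: if m < (k + 1) ^ 2 and gam m <= 2 r, then
    scale k <= r. *)
Definition scale k : R := gam lam (k.+1 ^ 2) / 2.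

Hypothesis L_ge : forall k, 2^-1 ^+ L k <= scale k.
Variable h : R -> R.
Hypothesis h_tail : forall N x,
  `|h x - \sum_(k < N) 2^-1 ^+ k * wave lam p L k x| <= 2 * 2^-1 ^+ N.

Lemma block_lt j k : (j < k)%N -> (block_end p L j <= p k)%N.
Proof.
elim: k => // k IH; rewrite ltnS leq_eqVlt => /orP[/eqP ->|/IH jk]; first exact: block_sep.
apply: leq_trans jk _; apply: leq_trans (block_sep k).
by rewrite /block_end leq_addr.
Qed.

(** The point is the left end of all its intervals beyond level n, so waves of every index can be
    evaluated there, including those that read digits past n. *)
Lemma wave_pos j n (u : nat -> bool) : (forall i, (n <= i)%N -> u i = false) ->
  wave lam p L j (pos lam n u) = (digits p L j u)%:R / 2 ^+ L j.
Proof.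
move=> u0; apply: wave_at => //.
  have [qn|/ltnW qn] := leqP (block_end p L j) n.
    by have [] := pos_nested lam_gt0 lam_le u qn.
  by rewrite (pos_stable lam qn u0).
have [qn|/ltnW qn] := leqP (block_end p L j) n.
  have [_] := pos_nested lam_gt0 lam_le u qn; have := len_gt0 lam_gt0 n; lra.
by rewrite (pos_stable lam qn u0) lerDl ltW // len_gt0.
Qed.

(** With th = eta ^ 3, one factor eta ^ m absorbs 2 ^ k and the other two absorb the square of m +
    4. *)
Lemma exp_poly_bound (th : R) : 0 < th -> th < 1 ->
  exists2 C, 0 <= C & forall m k : nat, (k ^ 2 <= m)%N ->
    th ^+ m * 2 ^+ k * (2 * (m.+4)%:R ^+ 2) <= C.
Proof.
move=> th0 th1; pose eta := th `^ 3^-1.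
have eta0 : 0 < eta by exact: powR_gt0.
have eta1 : eta < 1.
  suff : th `^ 3^-1 < 1 `^ 3^-1 by rewrite powR1.
  by apply: gt0_ltr_powR; rewrite ?nnegrE // ltW.
have eta3 : eta ^+ 3 = th.
  by rewrite -powR_mulrn ?powR_ge0 // -powRrM mulVf // powRr1 // ltW.
pose d := eta^-1 - 1.
have d0 : 0 < d by rewrite subr_gt0 invf_gt1.
(* Bernoulli's inequality for 1 / eta = 1 + d. *)
have bern m : eta ^+ m * (1 + m%:R * d) <= 1.
  elim: m => [|m IH]; first by rewrite expr0 mul0r addr0 mulr1.
  apply: le_trans IH; rewrite exprSr -mulrA ler_wpM2l ?exprn_ge0 ?(ltW eta0) //.
  have -> : eta = (1 + d)^-1 by rewrite /d addrCA subrr addr0 invrK.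
  rewrite mulrC ler_pdivrMr; last lra.
  rewrite -addn1 natrD; have : 0 <= m%:R :> R by [].
  by nra.
pose C1 := 4 + d^-1.
have C10 : 0 <= C1 by rewrite addr_ge0 // invr_ge0 ltW.
have b1 m : eta ^+ m * (m.+4)%:R <= C1.
  apply: (@le_trans _ _ (C1 * (eta ^+ m * (1 + m%:R * d)))); last by rewrite ler_piMr.
  rewrite mulrCA ler_wpM2l ?exprn_ge0 ?(ltW eta0) //.
  rewrite (_ : C1 * _ = m%:R + 4 + 4 * (m%:R * d) + d^-1); last by rewrite /C1; field; rewrite gt_eqF.
  have -> : (m.+4)%:R = m%:R + 4 :> R by rewrite -addn4 natrD.
  rewrite -addrA lerDl addr_ge0 ?invr_ge0 ?(ltW d0) // mulr_ge0 // mulr_ge0 //; exact: ltW.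
have [j ej] : exists j, eta ^+ j <= 2^-1.
  have [j jd] : exists j : nat, 1 < j%:R * d.
    exists (Num.truncn d^-1).+1; rewrite -ltr_pdivrMr // div1r.
    by have /andP[] := truncn_itv (ltW (etrans (invr_gt0 d) d0)).
  exists j; have := bern j.
  have e0 : 0 <= eta ^+ j by rewrite exprn_ge0 // ltW.
  by nra.
(* For k >= j one has m >= k ^ 2 >= j k, hence eta ^ m <= (eta ^ j) ^ k <= 2 ^- k. *)
have b2 m k : (k ^ 2 <= m)%N -> eta ^+ m * 2 ^+ k <= 2 ^+ j.
  move=> km; have [kj|/ltnW jk] := leqP k j.
    rewrite -[leRHS]mul1r; apply: ler_pM; rewrite ?exprn_ge0 ?(ltW eta0) //.
      by rewrite exprn_ile1 // ltW.
    by rewrite ler_weXn2l // ler1n.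
  apply: (@le_trans _ _ 1); last by rewrite exprn_ege1 // ler1n.
  apply: (@le_trans _ _ (2^-1 ^+ k * 2 ^+ k)); last by rewrite -exprMn mulVf // expr1n.
  rewrite ler_wpM2r ?exprn_ge0 //.
  apply: (@le_trans _ _ ((eta ^+ j) ^+ k)).
    rewrite -exprM; apply: ler_wiXn2l; rewrite ?(ltW eta0) ?(ltW eta1) //.
    by apply: leq_trans km; rewrite expnS expn1 leq_mul2r jk orbT.
  by apply: lerXn2r; rewrite ?nnegrE ?exprn_ge0 // ltW.
exists (2 * (2 ^+ j) * C1 ^+ 2); first by rewrite !mulr_ge0 // exprn_ge0.
move=> m k km; rewrite -eta3 -exprM mulnC exprM.
rewrite (_ : _ * _ = 2 * (eta ^+ m * 2 ^+ k) * (eta ^+ m * (m.+4)%:R) ^+ 2); last by ring.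
have X0 : 0 <= eta ^+ m * (m.+4)%:R by rewrite mulr_ge0 // exprn_ge0 // ltW.
have Y0 : 0 <= eta ^+ m * 2 ^+ k by rewrite mulr_ge0 // exprn_ge0 // ltW.
apply: ler_pM; [by rewrite mulr_ge0|exact: exprn_ge0| |].
  by rewrite ler_wpM2l // b2.
by apply: lerXn2r; rewrite ?nnegrE // b1.
Qed.

Variables (w g : R -> R) (a Cw : R) (tau : nat -> bool) (l : nat).
Hypothesis a_neq0 : a != 0.
Hypothesis Cw_ge0 : 0 <= Cw.
Hypothesis w_modulus : forall k x y, I01 x -> I01 y -> `|x - y| <= len lam (p k) ->
  `|w x - w y| <= Cw * scale k.
Hypothesis gE : forall n u, (l <= n)%N -> (forall i, (i < l)%N -> u i = tau i) ->
  (forall i, (n <= i)%N -> u i = false) ->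
  g (pos lam n u) = w (pos lam n u) + a * h (pos lam n u).

(** Counting the words of length n with the prefix of length [l] replaces a measure on the part of
    the graph above one cylinder. *)
Definition cyl n : {set {ffun 'I_n -> bool}} :=
  [set f : {ffun 'I_n -> bool} | [forall i : 'I_n, (i < l)%N ==> (f i == tau i)]]%SET.

Lemma cylP n (f : {ffun 'I_n -> bool}) i : (l <= n)%N -> f \in cyl n -> (i < l)%N ->
  ext f i = tau i.
Proof.
move=> ln; rewrite inE => /forallP H il; have lin := leq_trans il ln.
have := H (Ordinal lin); rewrite il /= => /eqP <-.
by rewrite -[i in LHS]/(val (Ordinal lin)) ext_ord.
Qed.

Lemma card_cyl n : (l <= n)%N -> (2 ^ (n - l) <= #|cyl n|)%N.
Proof.
move=> ln; pose psi (f : {ffun 'I_(n - l) -> bool}) : {ffun 'I_n -> bool} :=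
  [ffun i : 'I_n => if (i < l)%N then tau i else ext f (i - l)].
have psi_inj : injective psi.
  move=> f f' ff; apply: ext_inj => i il.
  have iln : (l + i < n)%N by rewrite -ltn_subRL.
  have := congr1 (fun F : {ffun 'I_n -> bool} => F (Ordinal iln)) ff.
  by rewrite !ffunE /= ltnNge leq_addr /= addKn.
have -> : (2 ^ (n - l) = #|[set psi f | f : {ffun 'I_(n - l) -> bool}]%SET|)%N.
  by rewrite card_imset // card_ffun card_bool card_ord.
apply: subset_leq_card; apply/fintype.subsetP => _ /imsetP[f _ ->].
by rewrite inE; apply/forallP => i; apply/implyP => il; rewrite ffunE il.
Qed.

Definition hits n (c : R * R) (r : R) : {set {ffun 'I_n -> bool}} :=
  [set f : {ffun 'I_n -> bool} | (f \in cyl n) && `[< square c r (pos lam n (ext f), g (pos lam n (ext f))) >]]%SET.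

Lemma pos_I01 n u : I01 (pos lam n u).
Proof.
have [h1 h2] := pos_itv lam_gt0 lam_le n u; have := len_gt0 lam_gt0 n.
by rewrite /I01 /= in_itv /= => h3; apply/andP; split; lra.
Qed.

(* Two points of the same square of half-side r share the first m digits. If they also
   share all digits outside the k-th block, then [w] barely separates them, so that
   the k-th wave forces their k-th blocks, read as numbers, to be close. *)
Lemma hits_rigid n c r m k (f f' : {ffun 'I_n -> bool}) :
  (l <= n)%N -> (block_end p L k <= n)%N -> (0 < m <= p k)%N ->
  2 * r < gam lam m.-1 -> scale k <= r ->
  f \in hits n c r -> f' \in hits n c r ->
  (forall i, (m <= i < p k)%N -> ext f i = ext f' i) ->
  (forall i, (block_end p L k <= i)%N -> ext f i = ext f' i) ->
  `|(digits p L k (ext f))%:R - (digits p L k (ext f'))%:R| <=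
    (Cw + 2) * r * 2 ^+ k * 2 ^+ L k / `|a| /\
  (forall i, (i < p k)%N -> ext f i = ext f' i).
Proof.
move=> ln qn /andP[m0 mp] rm kr /finset.setIdP[fc /asboolP[/= f1 f2]].
move=> /finset.setIdP[fc' /asboolP[/= f1' f2']] mid tail.
have pn : (p k <= n)%N by apply: leq_trans qn; rewrite /block_end leq_addr.
have mn : (m.-1 < n)%N by rewrite prednK //; exact: leq_trans mp pn.
have dpos : `|pos lam n (ext f) - pos lam n (ext f')| <= 2 * r.
  rewrite (_ : _ - _ = (pos lam n (ext f) - c.1) - (pos lam n (ext f') - c.1)); last by ring.
  by apply: (le_trans (ler_normB _ _)); lra.
have low i : (i < p k)%N -> ext f i = ext f' i.
  move=> ip; have [im|mi] := ltnP i m; last by apply: mid; rewrite mi.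
  apply: (@pos_agree _ _ lam_gt0 lam_le m.-1 n n) => //; first exact: le_lt_trans dpos rm.
  by rewrite -ltnS prednK.
split => //.
have dg : `|g (pos lam n (ext f)) - g (pos lam n (ext f'))| <= 2 * r.
  rewrite (_ : _ - _ = (g (pos lam n (ext f)) - c.2) - (g (pos lam n (ext f')) - c.2)); last by ring.
  by apply: (le_trans (ler_normB _ _)); lra.
have dw : `|w (pos lam n (ext f)) - w (pos lam n (ext f'))| <= Cw * r.
  apply: (@le_trans _ _ (Cw * scale k)); last by rewrite ler_wpM2l.
  apply: w_modulus; [exact: pos_I01|exact: pos_I01|].
  have [a1 a2] := pos_nested lam_gt0 lam_le (ext f) pn.
  have [] := pos_nested lam_gt0 lam_le (ext f') pn; rewrite -(eq_pos lam low) => a3 a4.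
  have := len_gt0 lam_gt0 n => l0.
  by rewrite ler_norml; apply/andP; split; lra.
have fE := gE ln (fun i => cylP ln fc (i := i)) (ext_ge f).
have fE' := gE ln (fun i => cylP ln fc' (i := i)) (ext_ge f').
have dh := @h_diff _ _ _ _ _ h_tail k (pos lam n (ext f)) (pos lam n (ext f')).
rewrite !wave_pos // in dh; try exact: ext_ge.
have {}dh : h (pos lam n (ext f)) - h (pos lam n (ext f')) = 2^-1 ^+ k *
   (((digits p L k (ext f))%:R - (digits p L k (ext f'))%:R) / 2 ^+ L k).
  rewrite dh ?mulrBl // => j jk; rewrite !wave_pos; try exact: ext_ge.
  congr (_%:R / _); apply: digits_ext => i /andP[pi iq].
  have [jk'|kj|//] := ltngtP j k.
    by apply: low; apply: leq_trans iq (block_lt jk').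
  by apply: tail; apply: leq_trans (block_lt kj) pi.
set v := _%:R - _%:R in dh *.
have av : `|a| * (2^-1 ^+ k * (`|v| / 2 ^+ L k)) <= (Cw + 2) * r.
  have -> : `|a| * (2^-1 ^+ k * (`|v| / 2 ^+ L k)) =
      `|a * (h (pos lam n (ext f)) - h (pos lam n (ext f')))|.
    by rewrite dh !normrM normfV !(ger0_norm (exprn_ge0 _ _)) // invr_ge0.
  rewrite (_ : a * _ = (g (pos lam n (ext f)) - g (pos lam n (ext f'))) -
     (w (pos lam n (ext f)) - w (pos lam n (ext f')))); last by rewrite fE fE'; ring.
  by apply: (le_trans (ler_normB _ _)); lra.
have a0 : 0 < `|a| by rewrite normr_gt0.
rewrite ler_pdivlMr // -ler_pdivrMr ?exprn_gt0 // -ler_pdivrMr ?exprn_gt0 //.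
apply: le_trans av; rewrite exprVn le_eqVlt; apply/orP; left; apply/eqP.
by field; rewrite !expf_neq0.
Qed.

Lemma eq_of_mod_dist (v v' D : nat) : `|v%:R - v'%:R : R| < D%:R -> v = v' %[mod D] -> v = v'.
Proof.
wlog vv : v v' / (v <= v')%N => [wl|].
  have [/wl//|/ltnW /wl H] := leqP v v'.
  by rewrite distrC => d /esym m; rewrite (H d m).
rewrite distrC -natrB // normr_nat ltr_nat => vD /esym/eqP.
rewrite eqn_mod_dvd // => Dv.
have v0 : (v' - v)%N = 0%N.
  by case: (posnP (v' - v)%N) => // p0; have := dvdn_leq p0 Dv; rewrite leqNgt vD.
by rewrite -(subnKC vv) v0 addn0.
Qed.

(** A word is encoded by its digits in [m, p k), its digits past the k-th block, and its block
    number modulo D + 1. By [hits_rigid] this code is injective: the first m digits are forced, and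
    block numbers at distance at most Z < D + 1 are told apart by their residues. *)
Lemma card_hits n c r m k : (l <= n)%N -> (block_end p L k <= n)%N ->
  (0 < m <= p k)%N -> 0 <= r -> 2 * r < gam lam m.-1 -> scale k <= r ->
  (#|hits n c r| <= 2 ^ (p k - m) * 2 ^ (n - block_end p L k) *
    (Num.truncn ((Cw + 2) * r * 2 ^+ k * 2 ^+ L k / `|a|)).+1)%N.
Proof.
move=> ln qn mp r0 rm kr; set Z := _ / `|a|; set D := Num.truncn Z.
have Z0 : 0 <= Z.
  by rewrite /Z divr_ge0 // !mulr_ge0 ?exprn_ge0 ?addr_ge0.
pose Phi (f : {ffun 'I_n -> bool}) :
    {ffun 'I_(p k - m) -> bool} * {ffun 'I_(n - block_end p L k) -> bool} * 'I_D.+1 :=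
  ([ffun i : 'I_(p k - m) => ext f (m + i)],
   [ffun i : 'I_(n - block_end p L k) => ext f (block_end p L k + i)],
   inord (digits p L k (ext f) %% D.+1)).
have Phi_inj : {in hits n c r &, injective Phi}.
  move=> f f' hf hf' [e1 e2 e3].
  have mid i : (m <= i < p k)%N -> ext f i = ext f' i.
    move=> /andP[mi ip]; have im : (i - m < p k - m)%N by rewrite ltn_sub2r // (leq_ltn_trans mi ip).
    have := congr1 (fun F : {ffun 'I_(p k - m) -> bool} => F (Ordinal im)) e1.
    by rewrite !ffunE /= subnKC.
  have tail i : (block_end p L k <= i)%N -> ext f i = ext f' i.
    move=> qi; have [lin|ni] := ltnP i n; last by rewrite !ext_ge.
    have iq : (i - block_end p L k < n - block_end p L k)%N.
      by rewrite ltn_sub2r // (leq_ltn_trans qi lin).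
    have := congr1 (fun F : {ffun 'I_(n - block_end p L k) -> bool} => F (Ordinal iq)) e2.
    by rewrite !ffunE /= subnKC.
  have [dd low] := hits_rigid ln qn mp rm kr hf hf' mid tail.
  have dE : digits p L k (ext f) = digits p L k (ext f').
    apply: (@eq_of_mod_dist _ _ D.+1).
      apply: le_lt_trans dd _; rewrite -/Z.
      by have /andP[] := truncn_itv Z0.
    by have := congr1 val e3; rewrite /= !inordK ?ltn_pmod.
  apply: ext_inj => i lin; have [ip|pi] := ltnP i (p k); first exact: low.
  have [iq|qi] := ltnP i (block_end p L k); last exact: tail.
  have := @binary_inj (fun j => ext f (p k + j)%N) (fun j => ext f' (p k + j)%N) _ dE (i - p k)%N.
  rewrite subnKC //; apply.
  by rewrite ltn_subLR.
rewrite -(card_in_imset Phi_inj); apply: leq_trans (max_card _) _.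
by rewrite !card_prod !card_ffun !card_bool !card_ord.
Qed.

Lemma gam_small (r : R) : 0 < r -> exists m, gam lam m <= r.
Proof.
move=> r0; exists (Num.truncn r^-1).
have r10 : 0 <= r^-1 by rewrite invr_ge0 ltW.
have /andP[_ h1] := truncn_itv r10.
apply: le_trans (gam_le_len lam_gt0 lam_le _) _.
apply: le_trans (len_le_inv lam_gt0 lam_le _) _.
rewrite -[leRHS]invrK lef_pV2 ?posrE ?invr_gt0 //.
by apply: le_trans (ltW h1) _; rewrite ler_nat ltnS; do 2 apply: leqW.
Qed.

(** Up to constants, the proportion of words that hit is r 2 ^ k 2 ^- m. Here 2 ^- m is (lam ^ (t -
    1)) ^ m th ^ m, and r ^ (t - 1) is at least (lam ^ (t - 1)) ^ m / Y with Y quadratic in m; the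
    slack th ^ m absorbs both 2 ^ k and Y. *)
Lemma hits_bound (t : R) : 1 < t -> t < s -> exists2 C, 0 <= C &
  forall c r, 0 < r -> r < 32^-1 -> exists n0, forall n, (n0 <= n)%N ->
    #|hits n c r|%:R <= C * r `^ t * 2 ^+ n.
Proof.
move=> t1 ts; set th := lam `^ (s - t).
have th0 : 0 < th by exact: powR_gt0.
have th1 : th < 1 by apply: powR_lt1 => //; lra.
have [C2 C20 C2P] := exp_poly_bound th0 th1.
have a0 : 0 < `|a| by rewrite normr_gt0.
pose C1 := (Cw + 2) / `|a| + 1.
have C10 : 0 <= C1.
  by rewrite addr_ge0 // divr_ge0 // addr_ge0.
exists (C1 * C2) => [|c r r0 r32]; first exact: mulr_ge0.
have r20 : 0 < 2 * r by lra.
(* By minimality 2 r < gam (m - 1), so the points of one square share their first m digits. The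
   bound r < 1/32 excludes m = 0, since gam 0 = 1/16. *)
case: (ex_minnP (gam_small r20)) => m gm mmin.
have m0 : (0 < m)%N.
  rewrite lt0n; apply/eqP => m0; move: gm; rewrite m0 /gam expr0 div1r -natrX => h1.
  have : (4 ^ 2)%:R^-1 = 16^-1 :> R by [].
  by move: h1; lra.
have rm : 2 * r < gam lam m.-1.
  rewrite ltNge; apply/negP => /mmin; by rewrite leqNgt prednK ?leqnn.
have exk : exists k, (k ^ 2 <= m)%N by exists 0%N.
have bk k : (k ^ 2 <= m)%N -> (k <= m)%N.
  by apply: leq_trans; rewrite expnS expn1; case: k => // k; rewrite leq_pmulr.
case: (ex_maxnP exk bk) => k km kmax.
have mk : (m < k.+1 ^ 2)%N.
  by rewrite ltnNge; apply/negP => /kmax; rewrite ltnn.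
have kr : scale k <= r.
  by rewrite /scale; have := gam_le lam_gt0 lam_le (ltnW mk); lra.
have mp : (0 < m <= p k)%N by rewrite m0 (leq_trans (ltnW mk)).
exists (maxn l (block_end p L k)) => n; rewrite geq_max => /andP[ln qn].
have := card_hits c ln qn mp (ltW r0) rm kr; rewrite -(ler_nat R).
move=> /le_trans; apply; rewrite !natrM !natrX.
set Z := _ / `|a|.
have Z0 : 0 <= Z.
  by rewrite /Z divr_ge0 // !mulr_ge0 ?exprn_ge0 ?addr_ge0 // ltW.
have rL : 1 <= r * 2 ^+ L k.
  have := le_trans (L_ge k) kr; rewrite exprVn -(@ler_pM2r _ (2 ^+ L k)) ?exprn_gt0 //.
  by rewrite mulVf // expf_neq0.
have k1 : 1 <= 2 ^+ k :> R by rewrite exprn_ege1 // ler1n.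
have DZ : (Num.truncn Z).+1%:R <= C1 * (r * 2 ^+ L k * 2 ^+ k).
  rewrite -addn1 natrD; apply: (@le_trans _ _ (Z + 1)); first by rewrite lerD2r truncn_le.
  rewrite /C1 mulrDl mul1r; apply: lerD.
    by rewrite /Z le_eqVlt; apply/orP; left; apply/eqP; ring.
  by rewrite mulr_ege1.
apply: (@le_trans _ _ (2 ^+ (p k - m) * 2 ^+ (n - block_end p L k) * (C1 * (r * 2 ^+ L k * 2 ^+ k)))).
  by rewrite ler_wpM2l // mulr_ge0 ?exprn_ge0.
have nE : 2 ^+ n = 2 ^+ (p k - m) * 2 ^+ (n - block_end p L k) * 2 ^+ L k * 2 ^+ m :> R.
  rewrite -!exprD; congr (_ ^+ _); move/andP: mp => [_ mpk].
  exact: split_length.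
rewrite nE.
set P := 2 ^+ (p k - m); set Q := 2 ^+ (n - _).
have PQ0 : 0 <= P * Q * 2 ^+ L k * C1 * r.
  by rewrite !mulr_ge0 ?exprn_ge0 // ltW.
rewrite (_ : P * Q * _ = P * Q * 2 ^+ L k * C1 * r * 2 ^+ k); last by ring.
have -> : r `^ t = r * r `^ (t - 1) by rewrite mulr_powRB1 ?(ltW r0) //; lra.
rewrite (_ : C1 * C2 * _ * _ = P * Q * 2 ^+ L k * C1 * r * (C2 * r `^ (t - 1) * 2 ^+ m)); last by ring.
rewrite ler_wpM2l //.
set X := (lam `^ (t - 1)) ^+ m.
have X0 : 0 <= X by rewrite exprn_ge0 // powR_ge0.
have two : 2 ^- m = X * th ^+ m :> R.
  rewrite /X /th -exprMn -powRD; last by rewrite (gt_eqF lam_gt0) implybT.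
  by rewrite (_ : t - 1 + (s - t) = s - 1) ?lam_s ?exprVn //; ring.
pose Y : R := 2 * m.+4%:R ^+ 2.
have Y1 : 1 <= Y.
  have : 1 <= m.+4%:R :> R by rewrite ler1n.
  by rewrite /Y; nra.
have Y0 : 0 < Y by lra.
have rX : X / Y <= r `^ (t - 1).
  apply: (@le_trans _ _ ((lam ^+ m / Y) `^ (t - 1))); last first.
    apply: ge0_ler_powR; rewrite ?nnegrE ?divr_ge0 ?exprn_ge0 ?(ltW lam_gt0) ?(ltW r0) ?(ltW Y0) //; first by lra.
    rewrite ler_pdivrMr //; move: gm; rewrite /gam ler_pdivrMr ?exprn_gt0 //.
    by rewrite /Y; lra.
  rewrite powRM ?exprn_ge0 ?invr_ge0 ?(ltW lam_gt0) ?(ltW Y0) // powR_pow //.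
  (* The power t - 1 of 1 / Y is at least 1 / Y because Y >= 1 and t - 1 <= 1; the latter uses s <=
     2. *)
  rewrite -/X; apply: (ler_wpM2l X0); apply: ger1_powR; last first.
    by move: ts s_le2; lra.
  by rewrite invr_gt0 Y0 /= invf_le1.
have key := C2P m k km; rewrite -/Y in key.
have m20 : 0 < 2 ^+ m :> R by rewrite exprn_gt0.
rewrite -ler_pdivrMr // two.
apply: (@le_trans _ _ (C2 * (X / Y))); last by rewrite ler_wpM2l.
rewrite (mulrA C2) ler_pdivlMr // (_ : _ * Y = X * (th ^+ m * 2 ^+ k * Y)); last by ring.
by rewrite mulrC ler_wpM2r.
Qed.

Lemma card_cyl_hits n (N : nat) (c : nat -> R * R) (r : nat -> R) :
  (l <= n)%N -> (forall x, I01 x -> exists2 i, (i < N)%N & square (c i) (r i) (x, g x)) ->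
  (2 ^ (n - l) <= \sum_(i < N) #|hits n (c i) (r i)|)%N.
Proof.
move=> ln cov; apply: leq_trans (card_cyl ln) _; rewrite -sum1_card.
apply: (@leq_trans (\sum_(f in cyl n) \sum_(i < N) (f \in hits n (c i) (r i)))).
  apply: leq_sum => f fc.
  have [i iN Si] := cov _ (pos_I01 n (ext f)).
  rewrite (bigD1 (Ordinal iN)) //=.
  suff -> : f \in hits n (c i) (r i) by [].
  by apply/finset.setIdP; split => //; apply/asboolP.
rewrite exchange_big /=; apply: leq_sum => i _.
rewrite -sum1_card [leqRHS]big_mkcond /= [leqLHS]big_mkcond /=.
by apply: leq_sum => f _; case: ifP => // _; case: ifP.
Qed.

(** The squares are closed, so compactness asks for slightly larger radii. Finiteness later permits
    one word length n that suits all squares. *)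
Lemma I01_finite_cover (c : nat -> R * R) (r r' : nat -> R) : C01 g ->
  graph g (@I01 R) `<=` \bigcup_i square (c i) (r i) -> (forall i, r i < r' i) ->
  exists N : nat, forall x, I01 x -> exists2 i, (i < N)%N & square (c i) (r' i) (x, g x).
Proof.
move=> [cg _] cov rr'.
have : near_covering (@I01 R) by apply/compact_near_coveringP; exact: segment_compact.
move=> /(_ nat \oo (fun N x => I01 x -> exists2 i, (i < N)%N & square (c i) (r' i) (x, g x))).
move=> /(_ _) [].
  move=> x Ix; have [i _ [/= s1 s2]] := cov (x, g x) (conj Ix erefl).
  have d0 : 0 < r' i - r i by rewrite subr_gt0.
  have /subspace_continuousP/(_ x Ix)/cvgrPdist_lt/(_ _ d0) near_g := cg.
  exists ([set y | ball x (r' i - r i) y /\ (I01 y -> `|g x - g y| < r' i - r i)],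
    [set N | (i < N)%N]).
    split => /=; last by exists i.+1.
    by apply: filterI; [exact: nbhsx_ballx|exact: near_g].
  move=> [y N] /= [[xy gxy] iN] Iy; exists i => //; split => /=.
    rewrite (_ : y - _ = (x - (c i).1) - (x - y)); last by ring.
    by apply: (le_trans (ler_normB _ _)); move: xy; rewrite /ball /=; lra.
  rewrite (_ : g y - _ = (g x - (c i).2) - (g x - g y)); last by ring.
  by apply: (le_trans (ler_normB _ _)); have := gxy Iy; lra.
move=> N _ NP; exists N => x Ix; exact: (NP N (leqnn N) x Ix Ix).
Qed.

Lemma graph_not_null (t : R) : C01 g -> 1 < t -> t < s -> ~ null_content t (graph g (@I01 R)).
Proof.
move=> Cg t1 ts; have [C C0 CP] := hits_bound t1 ts => null.
have t0 : 0 < t by lra.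
have tV0 : 0 < t^-1 by rewrite invr_gt0.
have l20 : 0 < 2 ^+ l :> R by rewrite exprn_gt0.
have K0 : 0 < 2 * (C + 1) * 2 ^+ l by rewrite mulr_gt0 // mulr_gt0 //; lra.
(* The first bound keeps all radii below 1/32. The second gives C e2 2 ^ l <= 1/2, whereas counting
   the words of a cover will force 1 <= C e2 2 ^ l. *)
pose e2 := Num.min (64^-1 `^ t) (2 * (C + 1) * 2 ^+ l)^-1.
have e20 : 0 < e2 by rewrite lt_min powR_gt0 // invr_gt0.
have e10 : 0 < e2 / 2 by rewrite divr_gt0.
have [c [r [r0 cr re]]] := null _ e10.
(* Enlarges every radius, zero ones included, while the t-th powers grow by at most e2 / 2 in
   total. *)
pose r' i := (r i `^ t + e2 / 2 * 2^-1 ^+ i.+1) `^ t^-1.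
have d0 i : 0 < e2 / 2 * 2^-1 ^+ i.+1 by rewrite mulr_gt0 // exprn_gt0.
have r't i : r' i `^ t = r i `^ t + e2 / 2 * 2^-1 ^+ i.+1.
  by rewrite /r' -powRrM mulVf ?gt_eqF // powRr1 // addr_ge0 ?powR_ge0 // ltW.
have rr' i : r i < r' i.
  have -> : r i = (r i `^ t) `^ t^-1 by rewrite -powRrM mulfV ?gt_eqF // powRr1.
  apply: gt0_ltr_powR; rewrite ?nnegrE ?powR_ge0 ?addr_ge0 ?powR_ge0 ?(ltW (d0 i)) //.
  by rewrite ltrDl.
have r'0 i : 0 < r' i by apply: le_lt_trans (rr' i).
have r'e n : \sum_(i < n) r' i `^ t <= e2.
  rewrite (eq_bigr (fun i : 'I_n => r i `^ t + e2 / 2 * 2^-1 ^+ i.+1)); last by move=> i _; rewrite r't.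
  rewrite big_split /= [leRHS]splitr; apply: lerD; first exact: re.
  by apply: geo_half_sum; exact: ltW.
have r'32 i : r' i < 32^-1.
  suff : r' i <= 64^-1 by lra.
  rewrite leNgt; apply/negP => h1.
  have : 64^-1 `^ t < r' i `^ t.
    by apply: gt0_ltr_powR; rewrite ?nnegrE // ltW.
  have : r' i `^ t <= e2.
    apply: le_trans (r'e i.+1); rewrite big_ord_recr /= lerDr sumr_ge0 // => j _.
    exact: powR_ge0.
  have : e2 <= 64^-1 `^ t by rewrite ge_min lexx.
  by lra.
have [N NP] := I01_finite_cover Cg cr rr'.
have /choice[n0 n0P] := fun i => CP (c i) (r' i) (r'0 i) (r'32 i).
pose n := maxn l (\max_(i < N) n0 i)%N.
have ln : (l <= n)%N by rewrite leq_maxl.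
have n0n (i : 'I_N) : (n0 i <= n)%N.
  by apply: leq_trans (leq_maxr _ _); exact: (leq_bigmax i).
have := card_cyl_hits ln NP; rewrite -(ler_nat R) natrX natr_sum => le1.
have : 2 ^+ (n - l) <= C * e2 * 2 ^+ n :> R.
  apply: (le_trans le1); apply: (@le_trans _ _ (\sum_(i < N) C * r' i `^ t * 2 ^+ n)).
    by apply: ler_sum => i _; exact: n0P.
  rewrite -mulr_suml -mulr_sumr ler_wpM2r ?exprn_ge0 //.
  by rewrite ler_wpM2l.
rewrite -{2}(subnK ln) exprD mulrCA -[leLHS]mulr1 ler_pM2l ?exprn_gt0 // => le2.
have e2K : e2 * (2 * (C + 1) * 2 ^+ l) <= 1.
  by rewrite -ler_pdivlMr // div1r /e2 ge_min lexx orbT.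
have : e2 * (2 * 2 ^+ l) > 0 by rewrite !mulr_gt0.
have CeL0 : 0 <= C * e2 * 2 ^+ l by rewrite !mulr_ge0 // ltW.
by move: le2 e2K CeL0; set T := 2 ^+ l; nra.
Qed.

End LowerBound.

(** * Closed infinite-dimensional extensions *)

Section RoughSystems.
Variable R : realType.

(** The constant C makes the functions with a given [delta] a linear space, so that one [delta]
    serves a whole finite-dimensional subspace. *)
Definition has_modulus (delta : R -> R) (w : R -> R) : Prop :=
  exists2 C, 0 <= C & forall e x y, 0 < e -> I01 x -> I01 y ->
    `|x - y| <= delta e -> `|w x - w y| <= C * e.

(* Quantified over all [w] at once: adding [a j * phi j * h] to [w] never pushes the
   dimension above [s], and lifts it to [s] as soon as [w] has modulus [delta]. *)
Record rough_system (s : R) (delta : R -> R) (h : R -> R) (phi : nat -> R -> R)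
    (y : nat -> R) : Prop := RoughSystem {
  rough_continuous : continuous h;
  window_continuous : forall j, continuous (phi j);
  window_bound : forall j x, `|phi j x| <= 1;
  window_disjoint : forall i j x, phi i x != 0 -> phi j x != 0 -> i = j;
  window_support : forall j x, phi j x != 0 -> 4^-1 < x /\ x < 3 / 4;
  window_node : forall j, phi j (y j) = 1;
  rough_node : forall j, h (y j) != 0;
  rough_upper : forall t M (w g : R -> R) (a : nat -> R), s < t -> 0 <= M ->
    (forall x, `|g x| <= M) -> null_content t (graph w (@I01 R)) ->
    (forall x, (forall j, phi j x = 0) -> g x = w x) ->
    (forall j x, phi j x != 0 -> g x = w x + a j * (phi j x * h x)) ->
    null_content t (graph g (@I01 R));
  rough_lower : forall t (w g : R -> R) (a : R) j, C01 g -> has_modulus delta w ->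
    a != 0 -> (forall x, phi j x != 0 -> g x = w x + a * (phi j x * h x)) ->
    1 < t -> t < s -> ~ null_content t (graph g (@I01 R)) }.

Lemma block_exists (lam : R) (delta : R -> R) : 0 < lam -> lam <= 2^-1 ->
  (forall e, 0 < e -> 0 < delta e) -> exists p L : nat -> nat,
  [/\ forall k, (block_end p L k <= p k.+1)%N,
      forall k, (k.+1 ^ 2 <= p k)%N,
      forall k, 2^-1 ^+ L k <= scale lam k
    & forall k, len lam (p k) <= delta (scale lam k)].
Proof.
move=> lam0 lam1 delta0.
have scale0 k : 0 < scale lam k by rewrite divr_gt0 // gam_gt0.
have inv (e : R) : 0 < e -> exists m : nat, forall n, (m <= n)%N -> n.+1%:R^-1 <= e.
  move=> e0; exists (Num.truncn e^-1) => n mn.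
  have e10 : 0 <= e^-1 by rewrite invr_ge0 ltW.
  have /andP[_ h1] := truncn_itv e10.
  rewrite -[leRHS]invrK lef_pV2 ?posrE ?invr_gt0 //.
  by apply: le_trans (ltW h1) _; rewrite ler_nat.
have /choice[L LP] : forall k, exists l, 2^-1 ^+ l <= scale lam k.
  move=> k; have [m mP] := inv _ (scale0 k); exists m.
  apply: le_trans (mP m (leqnn m)); rewrite exprVn lef_pV2 ?posrE ?exprn_gt0 //.
  by rewrite -natrX ler_nat ltn_expl.
have /choice[pf pfP] : forall k, exists f : nat -> nat, forall lo,
    [/\ (lo <= f lo)%N, (k.+1 ^ 2 <= f lo)%N & len lam (f lo) <= delta (scale lam k)].
  move=> k; have [m mP] := inv _ (delta0 _ (scale0 k)).
  exists (fun lo => maxn lo (maxn (k.+1 ^ 2) m)) => lo; split.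
  - by rewrite leq_maxl.
  - by rewrite leq_max leq_maxl orbT.
  - apply: le_trans (len_le_inv lam0 lam1 _) _.
    by apply: mP; apply: leqW; apply: leqW; rewrite leq_max (leq_max m) leqnn !orbT.
pose p := fix p k := if k is k'.+1 then pf k (p k' + L k')%N else pf 0%N 0%N.
exists p, L; split => //.
- by move=> k; have [+ _ _] := pfP k.+1 (p k + L k)%N.
- by case=> [|k]; [have [] := pfP 0%N 0%N|have [] := pfP k.+1 (p k + L k)%N].
- by case=> [|k]; [have [] := pfP 0%N 0%N|have [] := pfP k.+1 (p k + L k)%N].
Qed.

(** Cut after j + 1 digits, these are the words 1...10; they are pairwise incompatible and carry the
    windows. *)
Definition cyl_word (j i : nat) : bool := (i < j)%N.

Lemma rough_system_exists (s : R) (delta : R -> R) (X : seq R) : 1 < s -> s <= 2 ->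
  (forall e, 0 < e -> 0 < delta e) ->
  exists h phi y, rough_system s delta h phi y /\ forall j x, x \in X -> phi j x = 0.
Proof.
move=> s1 s2 delta0; pose lam : R := 2^-1 `^ (s - 1)^-1.
have lam0 : 0 < lam by rewrite powR_gt0 // invr_gt0.
have s10 : 0 < s - 1 by lra.
have lam1 : lam <= 2^-1.
  by apply: ge1r_powR; [lra|rewrite invf_ge1 //; lra].
have lams : lam `^ (s - 1) = 2^-1 by rewrite /lam -powRrM mulVf ?gt_eqF // powRr1.
have [p [L [bsep pge Lge dlen]]] := block_exists lam0 lam1 delta0.
have wC k : continuous (wave lam p L k).
  have [C' CP'] := wave_lipschitz lam0 p L k.
  exact: lipschitz_continuous CP'.
have [h [htail hC]] : exists h : R -> R,
    (forall N x, `|h x - \sum_(k < N) 2^-1 ^+ k * wave lam p L k x| <= 2 * 2^-1 ^+ N) /\ continuous h.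
  have [|||k x|h [hP hC]] := @weierstrass_test R (fun k x => 2^-1 ^+ k * wave lam p L k x) 1 2^-1.
  - by [].
  - by [].
  - by lra.
  - have /andP[w0 w1] := wave_itv lam0 lam1 p L k x.
    by rewrite mul1r normrM !ger0_norm ?exprn_ge0 // ler_piMr ?exprn_ge0.
  exists h; split => [N x|].
    apply: le_trans (hP N x) _; have -> : 1 - 2^-1 = 2^-1 :> R by lra.
    by rewrite mul1r invrK mulrC.
  by apply: hC => k x; apply: cvgM; [exact: cvg_cst|exact: wC].
pose phi0 j := plateau lam j.+1 (cyl_word j).
have disj i j x : phi0 i x != 0 -> phi0 j x != 0 -> i = j.
  wlog : i j / (i < j)%N => [wl hi hj|ij hi hj].
    by have [ij|ji|//] := ltngtP i j; [exact: wl hi hj|apply/esym; exact: wl hj hi].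
  have h0 : phi0 j x = 0.
    apply: (plateau_disjoint lam0 lam1 _ hi); exists i; first by rewrite ltnSn ltnS ltnW.
    by rewrite /cyl_word ltnn ij.
  by rewrite h0 eqxx in hj.
(* At each point of [X] at most one window is nonzero, so dropping the first J windows clears all of
   [X]. *)
have [J JP] : exists J, forall j x, (J <= j)%N -> x \in X -> phi0 j x = 0.
  elim: X => [|x0 X' [J JP]]; first by exists 0%N.
  have [[i pi]|N] := pselect (exists i, phi0 i x0 != 0); last first.
    exists J => j x Jj; rewrite inE => /orP[/eqP ->|]; last exact: JP.
    by apply/eqP/negPn/negP => pj; apply: N; exists j.
  exists (maxn J i.+1) => j x; rewrite geq_max => /andP[Jj ij].
  rewrite inE => /orP[/eqP ->|]; last exact: JP.
  by apply/eqP/negPn/negP => pj; move: ij; rewrite (disj _ _ _ pi pj) ltnn.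
(* Two points of the window are compared whose digits differ only in the j-th block: all true in
   [u], all false in [cyl_word j]. By [h_diff] the values of [h] differ, so one of them is
   nonzero. *)
have node j : exists y, phi0 j y = 1 /\ h y != 0.
  have L0 : (0 < L j)%N.
    rewrite lt0n; apply/eqP => L0; have := Lge j; rewrite L0 expr0 /scale.
    by have := gam_le16 lam0 lam1 (j.+1 ^ 2); lra.
  have jp : (j < p j)%N.
    by apply: leq_trans (pge j); rewrite expnS expn1 leq_pmulr.
  pose u i := (i < j)%N || ((p j <= i)%N && (i < block_end p L j)%N).
  have u0 i : (block_end p L j <= i)%N -> u i = false.
    move=> bi; rewrite /u ltnNge [(i < block_end _ _ _)%N]ltnNge bi andbF orbF.
    by apply/negbTE; rewrite negbK; apply: leq_trans bi; rewrite /block_end; apply: leq_trans (ltnW jp) _; rewrite leq_addr.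
  have v0 i : (block_end p L j <= i)%N -> cyl_word j i = false.
    by move=> bi; have := u0 i bi; rewrite /u /cyl_word; case: (i < j)%N.
  have jb : (j.+1 <= block_end p L j)%N by rewrite /block_end; apply: leq_trans jp _; rewrite leq_addr.
  have at1 (v : nat -> bool) : (forall i, (i < j.+1)%N -> cyl_word j i = v i) ->
      phi0 j (pos lam (block_end p L j) v) = 1.
    move=> vu; rewrite /phi0 (eq_plateau lam vu).
    have [h1 h2] := pos_nested lam0 lam1 v jb.
    by apply: plateau1 => //; have := len_gt0 lam0 (block_end p L j); lra.
  have au : phi0 j (pos lam (block_end p L j) u) = 1.
    apply: at1 => i; rewrite ltnS /u /cyl_word => ij.
    by rewrite [(p j <= i)%N]leqNgt (leq_ltn_trans ij jp) /= orbF.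
  have av : phi0 j (pos lam (block_end p L j) (cyl_word j)) = 1 by exact: at1.
  have dh := h_diff htail (k := j) (x := pos lam (block_end p L j) u)
    (y := pos lam (block_end p L j) (cyl_word j)).
  have {}dh := dh _; rewrite !(wave_pos lam0 lam1) // in dh.
  have [hu|hu] := eqVneq (h (pos lam (block_end p L j) u)) 0; last first.
    by exists (pos lam (block_end p L j) u).
  exists (pos lam (block_end p L j) (cyl_word j)); split => //; apply/eqP => hv.
  have : h (pos lam (block_end p L j) u) - h (pos lam (block_end p L j) (cyl_word j)) != 0.
    rewrite dh; last first.
      move=> k kj; rewrite !(wave_pos lam0 lam1) //; congr (_%:R / _).
      apply: digits_ext => i /andP[pi ib]; rewrite /u /cyl_word.
      have [//|ji] := ltnP i j; apply/negbTE/negP => /andP[pji ijb].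
      have [kj'|jk|//] := ltngtP k j.
        by have := leq_trans ib (leq_trans (block_lt bsep kj') pji); rewrite ltnn.
      by have := leq_trans ijb (leq_trans (block_lt bsep jk) pi); rewrite ltnn.
    have -> : digits p L j (cyl_word j) = 0%N.
      rewrite /digits big1 // => i _; rewrite /cyl_word.
      by rewrite ltnNge (leq_trans (ltnW jp)) ?leq_addr.
    rewrite mul0r subr0 mulf_neq0 ?expf_neq0 // mulf_neq0 ?invr_neq0 ?expf_neq0 //.
    have upj : u (p j) by rewrite /u leqnn /block_end -addn1 leq_add2l L0 orbT.
    by rewrite pnatr_eq0 -lt0n /digits (bigD1 (Ordinal L0)) //= !addn0 expn0 muln1 upj.
  by rewrite hu hv subrr eqxx.
have /choice[y0 y0P] := node.
exists h, (fun j => phi0 (J + j)%N), (fun j => y0 (J + j)%N); split; last first.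
  by move=> j x xX; apply: JP; rewrite ?leq_addr.
have phiL j : exists C, forall x y, `|phi0 j x - phi0 j y| <= C * `|x - y|.
  by exists (3 / gam lam j.+1); exact: plateau_lipschitz.
have phi1 j x : `|phi0 j x| <= 1.
  by rewrite ger0_norm; [exact: plateau_le1|exact: plateau_ge0].
split.
- exact: hC.
- by move=> j; have [C CP] := phiL (J + j)%N; exact: lipschitz_continuous CP.
- by move=> j; exact: phi1.
- by move=> i j x hi hj; apply/eqP; rewrite -(eqn_add2l J); apply/eqP; exact: disj hi hj.
- by move=> j x; exact: plateau_itv.
- by move=> j; have [] := y0P (J + j)%N.
- by move=> j; have [] := y0P (J + j)%N.
- move=> t M w g a st M0 gM wN g0 gphi.
  have pk k : (k <= p k)%N.
    by apply: leq_trans (pge k); rewrite expnS expn1; apply: leq_trans (leqnSn k) _; rewrite leq_pmulr.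
  apply: (null_content_perturbation lam0 lam1 lams pk htail st _ M0 gM wN _ _ g0 gphi) => //.
  by lra.
- move=> t w g a j Cg [Cw Cw0 wm] a0 gphi t1 ts.
  apply: (@graph_not_null R lam s lam0 lam1 lams s2 p L bsep pge Lge h htail w g a Cw
    (cyl_word (J + j)%N) (J + j).+1%N a0 Cw0) => //.
    move=> k x z Ix Iz xz; apply: wm => //; last exact: le_trans xz (dlen k).
    by rewrite divr_gt0 // gam_gt0.
  move=> n u ln uw u0.
  have p1 : phi0 (J + j)%N (pos lam n u) = 1.
    rewrite /phi0 -(eq_plateau lam uw).
    have [h1 h2] := pos_nested lam0 lam1 u ln.
    by apply: plateau1 => //; have := len_gt0 lam0 n; lra.
  by rewrite gphi p1 ?oner_neq0 // mul1r.
Qed.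

End RoughSystems.

(** * Finite-dimensional subspaces: projections by point values and common moduli *)

Section FiniteDimensionalSubspaces.
Variable R : realType.
Implicit Types (W : set (R -> R)) (f : nat -> R -> R).

(* A projection onto a finite-dimensional space that only reads off finitely many
   point values: this keeps the sums built below closed. *)
Record point_projection (W : set (R -> R)) (P : (R -> R) -> R -> R) (X : seq R) : Prop :=
  PointProjection {
  projD : forall u v, P (fun x => u x + v x) = (fun x => P u x + P v x);
  projZ : forall a u, P (fun x => a * u x) = (fun x => a * P u x);
  proj_in : forall u, W (P u);
  proj_vanish : forall u, (forall x, x \in X -> u x = 0) -> P u = @zerof R;
  proj_bound : forall x, exists2 C, 0 <= C & forall u e, (forall z, `|u z| <= e) -> `|P u x| <= C * e }.

(** Induction on the generators: if r is the part of [f n] missed by [P] and r z is nonzero, the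
    coefficient of r can be read off from u z - P u z, at the price of one more evaluation point. *)
Lemma point_projection_exists W n f : Defs.subspace W -> (forall i, (i < n)%N -> W (f i)) ->
  exists P X, point_projection W P X /\ forall i, (i < n)%N -> P (f i) = f i.
Proof.
move=> [_ [W0 [WD WZ]]]; elim: n => [|n IH] Wf.
  exists (fun _ => @zerof R), [::]; split => //; split => //.
  - by move=> u v; apply/funext => x; rewrite addr0.
  - by move=> a u; apply/funext => x; rewrite mulr0.
  - by move=> x; exists 0 => // u e _; rewrite normr0 mul0r.
have [i ni|P [X [[PD PZ PW P0 Pb] Pf]]] := IH; first by apply: Wf; exact: leqW.
pose r x := f n x - P (f n) x.
have [[z rz]|N] := pselect (exists z, r z != 0); last first.
  exists P, X; split => // i; rewrite ltnS leq_eqVlt => /orP[/eqP ->|]; last exact: Pf.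
  apply/funext => x; apply/eqP; rewrite eq_sym -subr_eq0; apply/negPn/negP => rx.
  by apply: N; exists x.
exists (fun u x => P u x + (u z - P u z) / r z * r x), (z :: X); split; first split.
- by move=> u v; apply/funext => x; rewrite PD; ring.
- by move=> a u; apply/funext => x; rewrite PZ; ring.
- move=> u; apply: (WD) => //; apply: (WZ).
  rewrite (_ : r = fun x => f n x + -1 * P (f n) x); last by apply/funext => x; rewrite mulN1r.
  by apply: (WD); [exact: Wf|exact: WZ].
- move=> u u0; rewrite P0; last by move=> x xX; apply: u0; rewrite inE xX orbT.
  by apply/funext => x; rewrite u0 ?inE ?eqxx // /zerof; ring.
- move=> x; have [C C0 CP] := Pb x; have [D D0 DP] := Pb z.
  exists (C + (1 + D) / `|r z| * `|r x|).
    by rewrite addr_ge0 // mulr_ge0 // divr_ge0 // addr_ge0.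
  move=> u e ue; apply: (le_trans (ler_normD _ _)); rewrite [leRHS]mulrDl.
  apply: lerD; first exact: CP.
  rewrite !normrM normfV -mulrA.
  rewrite (_ : _ * e = (1 + D) * e * (`|r z|^-1 * `|r x|)); last by ring.
  rewrite ler_wpM2r ?mulr_ge0 ?invr_ge0 //.
  by apply: (le_trans (ler_normB _ _)); rewrite mulrDl mul1r lerD //; exact: DP.
- move=> i; rewrite ltnS leq_eqVlt => /orP[/eqP ->|lin]; apply/funext => x.
    by rewrite -/(r z) divff // mul1r /r addrC subrK.
  by rewrite Pf // subrr mul0r mul0r addr0.
Qed.

Lemma common_modulus n f : (forall i, (i < n)%N -> C01 (f i)) ->
  exists delta : R -> R, (forall e, 0 < e -> 0 < delta e) /\
    forall i, (i < n)%N -> has_modulus delta (f i).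
Proof.
elim: n => [|n IH] fC; first by exists (fun=> 1).
have [i lin|d [d0 dP]] := IH; first by apply: fC; exact: leqW.
have /choice[d' d'P] : forall e, exists d', 0 < e -> 0 < d' /\
    forall x y, I01 x -> I01 y -> `|x - y| <= d' -> `|f n x - f n y| <= e.
  move=> e; have [e0|e0] := ltP 0 e; last by exists 0.
  by have [d' ? ?] := C01_modulus (fC n (ltnSn n)) e0; exists d'.
exists (fun e => Num.min (d e) (d' e)); split.
  by move=> e e0; rewrite lt_min d0 //=; have [] := d'P e e0.
move=> i; rewrite ltnS leq_eqVlt => /orP[/eqP ->|lin].
  exists 1 => // e x y e0 Ix Iy; rewrite le_min => /andP[_ xy].
  by rewrite mul1r; have [_] := d'P e e0; apply.
have [C C0 CP] := dP i lin; exists C => // e x y e0 Ix Iy.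
by rewrite le_min => /andP[xy _]; exact: CP.
Qed.

Lemma lspan_modulus (B : set (R -> R)) delta : B `<=` @C01 R ->
  (forall b, B b -> has_modulus delta b) -> forall w, lspan B w -> has_modulus delta w.
Proof.
move=> BC Bm; suff H : Defs.subspace (@C01 R `&` has_modulus delta).
  by move=> w Bw; have [] := lspan_sub H (fun b Bb => conj (BC b Bb) (Bm b Bb)) Bw.
split; first by move=> u [].
split; first by split; [exact: C01_zerof|exists 0 => // e x y *; rewrite subrr normr0 mul0r].
split.
  move=> u v [Cu [C C0 CP]] [Cv [D D0 DP]]; split; first exact: C01D.
  exists (C + D) => [|e x y e0 Ix Iy xy]; first exact: addr_ge0.
  rewrite opprD addrACA mulrDl; apply: (le_trans (ler_normD _ _)).
  by apply: lerD; [exact: CP|exact: DP].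
move=> a u [Cu [C C0 CP]]; split; first exact: C01Z.
exists (`|a| * C) => [|e x y e0 Ix Iy xy]; first exact: mulr_ge0.
by rewrite -mulrBr normrM -mulrA ler_wpM2l //; exact: CP.
Qed.

End FiniteDimensionalSubspaces.

(** * Cardinality of C[0,1] *)

Section Cardinality.
Variable R : realType.

(** The Cantor scheme with ratio 1/2 is reused: the supremum of the left ends coded by a sequence
    determines the sequence. *)
Lemma card_bool_seq_le : ([set: nat -> bool] #<= [set: R])%card.
Proof.
apply/pcard_injP; pose lam : R := 2^-1.
have lam0 : 0 < lam by rewrite invr_gt0.
have lam1 : lam <= 2^-1 by [].
pose S (b : nat -> bool) := [set pos lam n b | n in [set: nat]].
have ub b : has_ubound (S b).
  exists 1 => _ [n _ <-]; have [_] := pos_itv lam0 lam1 n b; have := len_gt0 lam0 n; lra.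
have lt b b' i : (forall j, (j < i)%N -> b j = b' j) -> b i = false -> b' i = true ->
    sup (S b) < sup (S b').
  move=> bb bi bi'; apply: (@lt_le_trans _ _ (pos lam i.+1 b')); last by apply: ub_le_sup => //; exists i.+1.
  apply: (@le_lt_trans _ _ (pos lam i.+1 b' - gam lam i)); last by rewrite gtrBl gam_gt0.
  apply: ge_sup; first by exists (pos lam 0 b), 0%N.
  move=> _ [n _ <-].
  have [ni|ni] := leqP n i.+1.
    have [h1 _] := pos_nested lam0 lam1 b ni.
    by have := pos_sep lam0 lam1 bb bi bi' (ltnSn i) (ltnSn i); have := len_gt0 lam0 i.+1; lra.
  by have := pos_sep lam0 lam1 bb bi bi' (ltnW ni) (ltnSn i); have := len_gt0 lam0 n; lra.
exists (fun b => sup (S b)) => b b' _ _ sbb; apply/funext => k; apply: contrapT => bk.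
have [i [_ bb bi]] := @first_difference k.+1 b b' (ex_intro2 _ _ k (ltnSn k) bk).
case bE : (b i); case bE' : (b' i); rewrite ?bE ?bE' // in bi.
  by have := lt b' b i (fun j ji => esym (bb j ji)) bE' bE; rewrite sbb ltxx.
by have := lt b b' i bb bE bE'; rewrite sbb ltxx.
Qed.

Lemma card_pred_countable (T : countType) :
  ([set: T -> bool] #<= [set: nat -> bool])%card.
Proof.
apply/pcard_injP; exists (fun E k => if unpickle k is Some x then E x else false).
move=> E F _ _ EF; apply/funext => x.
by have := congr1 (fun G => G (pickle x)) EF; rewrite /= pickleK.
Qed.

(** A continuous function is determined by the rational points strictly below its graph. *)
Lemma card_C01_le : (@C01 R #<= [set: R])%card.
Proof.
apply: (@card_le_trans _ _ _ [set: (rat * rat)%type -> bool]); last first.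
  exact: card_le_trans (card_pred_countable _) card_bool_seq_le.
apply/pcard_injP.
exists (fun f (q : rat * rat) => ratr q.2 < f (ratr q.1)).
move=> f g; rewrite !inE => Cf Cg fg.
have key (u v : R -> R) x : C01 u -> C01 v -> u x < v x ->
    exists q1 q2 : rat, ~~ (ratr q2 < u (ratr q1)) /\ ratr q2 < v (ratr q1).
  move=> Cu Cv uv.
  have Ix : I01 x.
    by apply: contrapT => Nx; rewrite Cu.2 // Cv.2 // ltxx in uv.
  pose e := (v x - u x) / 4; have e0 : 0 < e by rewrite divr_gt0 // subr_gt0.
  have [d d0 dP] := C01_modulus Cu e0; have [d' d'0 d'P] := C01_modulus Cv e0.
  have Ix' : 0 <= x <= 1 by move: Ix; rewrite /I01 /= in_itv.
  pose lo := Num.max 0 (x - Num.min d d'); pose hi := Num.min 1 (x + Num.min d d').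
  have m0 : 0 < Num.min d d' by rewrite lt_min d0.
  have lohi : lo < hi.
    by rewrite /lo /hi gt_max !lt_min; move: Ix' => /andP[x0 x1]; apply/andP; split; apply/andP; split; lra.
  have [q1] := rat_in_itvoo lohi; rewrite in_itv /= gt_max lt_min => /andP[/andP[a1 a2] /andP[a3 a4]].
  have Iq : I01 (ratr q1 : R) by rewrite /I01 /= in_itv /= !ltW.
  have xq : `|x - ratr q1| <= Num.min d d' by rewrite ler_norml; apply/andP; split; lra.
  move: xq; rewrite le_min => /andP[xq xq'].
  have hu := dP _ _ Ix Iq xq; have hv := d'P _ _ Ix Iq xq'.
  have uvlt : u x + e < v x - e by rewrite /e; lra.
  have [q2] := rat_in_itvoo uvlt; rewrite in_itv /= => /andP[b1 b2].
  exists q1, q2; rewrite -leNgt; move: hu hv; rewrite !ler_norml => /andP[hu1 hu2] /andP[hv1 hv2].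
  split; lra.
apply/funext => x; apply/eqP; rewrite eq_le; apply/andP; split; rewrite leNgt; apply/negP => uv.
  have [q1 [q2 [h1 h2]]] := key _ _ _ Cg Cf uv.
  have := congr1 (fun F => F (q1, q2)) fg; rewrite /= h2.
  by move/esym; rewrite (negbTE h1).
have [q1 [q2 [h1 h2]]] := key _ _ _ Cf Cg uv.
have := congr1 (fun F => F (q1, q2)) fg; rewrite /= h2.
by rewrite (negbTE h1).
Qed.

End Cardinality.

(** * The closed space of functions carried by the windows *)

Section Bundles.
Variables (R : realType) (s : R) (delta h : R -> R) (phi : nat -> R -> R) (y : nat -> R).
Hypothesis rough : rough_system s delta h phi y.

(** On the j-th window [u] is a multiple of [phi j] times [h]. The multiple u (y j) / h (y j) is
    hidden in a linear relation between two values of [u], a form that survives pointwise limits. *)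
Definition bundle : set (R -> R) := [set u | [/\ C01 u,
  forall x, (forall j, phi j x = 0) -> u x = 0 &
  forall j x, phi j x != 0 -> h (y j) * u x = phi j x * h x * u (y j)]].

Lemma bundle_subspace : Defs.subspace bundle.
Proof.
split; first by move=> u [].
split; first by split => [|//|j x _]; [exact: C01_zerof|rewrite /zerof !mulr0].
split.
  move=> u v [Cu u0 uE] [Cv v0 vE]; split; first exact: C01D.
    by move=> x px; rewrite u0 // v0 // addr0.
  by move=> j x px; rewrite !mulrDr uE // vE.
move=> a u [Cu u0 uE]; split; first exact: C01Z.
  by move=> x px; rewrite u0 // mulr0.
by move=> j x px; rewrite mulrCA uE // mulrCA.
Qed.

Lemma limit_identity (alpha beta a b K : R) :
  (forall e, 0 < e -> exists a' b', [/\ alpha * a' = beta * b',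
     `|a' - a| <= K * e & `|b' - b| <= K * e]) -> alpha * a = beta * b.
Proof.
move=> H; apply/eqP; rewrite -subr_eq0; apply/negPn/negP => d0.
pose d := `|alpha * a - beta * b|; have dp : 0 < d by rewrite normr_gt0.
pose M := (`|alpha| + `|beta|) * `|K| + 1.
have M0 : 0 < M by rewrite ltr_wpDl // mulr_ge0 // addr_ge0.
have e0 : 0 < d / (2 * M) by rewrite divr_gt0 // mulr_gt0.
have [a' [b' [ab aa bb]]] := H _ e0; set e := d / (2 * M) in e0 aa bb.
have : d <= M * e.
  rewrite /d (_ : _ - _ = beta * (b' - b) - alpha * (a' - a)); last by rewrite !mulrBr ab; ring.
  apply: (le_trans (ler_normB _ _)); rewrite !normrM.
  have h1 : `|beta| * `|b' - b| <= `|beta| * (`|K| * e).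
    by rewrite ler_wpM2l // (le_trans bb) // ler_wpM2r ?(ltW e0) // ler_norm.
  have h2 : `|alpha| * `|a' - a| <= `|alpha| * (`|K| * e).
    by rewrite ler_wpM2l // (le_trans aa) // ler_wpM2r ?(ltW e0) // ler_norm.
  by rewrite /M mulrDl mul1r; move: h1 h2 e0; set A := `|alpha|; set B := `|beta|; set k := `|K|; nra.
rewrite (_ : M * e = d / 2); last by rewrite /e; field; rewrite gt_eqF.
by lra.
Qed.

(** Each defining relation involves at most two points, so the approximants and the constant may
    depend on the pair; this fits [proj_bound], whose constant depends on the point. *)
Lemma bundle_closed (u : R -> R) : C01 u ->
  (forall x z, exists K, forall e, 0 < e -> exists u', [/\ bundle u',
     `|u' x - u x| <= K * e & `|u' z - u z| <= K * e]) -> bundle u.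
Proof.
move=> Cu H; split => //.
  move=> x px; have [K KP] := H x x; rewrite -[u x]mul1r -[RHS](mul0r (u x)).
  apply: (@limit_identity _ _ _ _ K) => e /KP[u' [[_ u'0 _] h1 h2]].
  by exists (u' x), (u' x); split => //; rewrite u'0 // !mulr0.
move=> j x px; have [K KP] := H x (y j).
apply: (@limit_identity _ _ _ _ K) => e /KP[u' [[_ _ u'E] h1 h2]].
by exists (u' x), (u' (y j)); split => //; exact: u'E.
Qed.

Lemma bundle_geometric (t : R) : 0 < t -> t < 1 ->
  exists2 u, bundle u & forall j, u (y j) = t ^+ j * h (y j).
Proof.
move=> t0 t1.
have [|||k x|G [GP GC]] := @weierstrass_test R (fun j x => t ^+ j * phi j x) 1 t.
- by [].
- exact: ltW.
- by [].
- rewrite mul1r normrM ger0_norm ?exprn_ge0 ?(ltW t0) // ler_piMr ?exprn_ge0 ?(ltW t0) //.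
  exact: window_bound rough k x.
have {}GC : continuous G.
  apply: GC => k x; apply: cvgM; first exact: cvg_cst.
  exact: window_continuous rough k x.
have Gj j x : phi j x != 0 -> G x = t ^+ j * phi j x.
  move=> pj; apply/eqP; rewrite -subr_eq0; apply/eqP.
  apply: (@eq0_geometric _ _ (1 / (1 - t)) t j.+1 (ltW t0) t1) => N jN.
  have -> : t ^+ j * phi j x = \sum_(k < N) t ^+ k * phi k x.
    rewrite (bigD1 (Ordinal jN)) //= big1 ?addr0 // => k kj.
    have [->|pk] := eqVneq (phi k x) 0; first by rewrite mulr0.
    by move: kj; rewrite -val_eqE /= (window_disjoint rough pk pj) eqxx.
  by rewrite mulrAC; exact: GP.
have G0 x : (forall j, phi j x = 0) -> G x = 0.
  move=> p0; apply: (@eq0_geometric _ _ (1 / (1 - t)) t 0 (ltW t0) t1) => N _.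
  have := GP N x; rewrite big1 ?subr0 => [|k _]; last by rewrite p0 mulr0.
  by rewrite mulrAC.
exists (fun x => G x * h x); last first.
  by move=> j; rewrite (Gj j) (window_node rough) ?oner_neq0 // mulr1.
split.
- split.
    by apply: continuous_subspaceT => x; apply: cvgM; [exact: GC|exact: (rough_continuous rough)].
  move=> x Nx; rewrite G0 ?mul0r // => j; apply/eqP/negPn/negP => pj.
  apply: Nx; have [x1 x2] := window_support rough pj.
  by rewrite /I01 /= in_itv /=; apply/andP; split; lra.
- by move=> x /G0 ->; rewrite mul0r.
- move=> j x pj; rewrite (Gj j x pj) (Gj j (y j)); last by rewrite (window_node rough) oner_neq0.
  by rewrite (window_node rough); ring.
Qed.

Lemma bundle_perturbation (t : R) (w u : R -> R) : s < t -> C01 w -> bundle u ->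
  null_content t (graph w (@I01 R)) ->
  null_content t (graph (fun x => w x + u x) (@I01 R)).
Proof.
move=> st Cw [Cu u0 uE] wN; have [M M0 gM] := C01_bounded (C01D Cw Cu).
apply: (rough_upper rough (a := fun j => u (y j) / h (y j)) st M0 gM wN).
  by move=> x px; rewrite u0 // addr0.
move=> j x px; congr (_ + _); apply: (mulfI (rough_node rough j)); rewrite uE //.
by field; exact: (rough_node rough).
Qed.

Lemma bundle_wild (t : R) (w u : R -> R) j : 1 < t -> t < s -> C01 w -> has_modulus delta w ->
  bundle u -> u (y j) != 0 -> ~ null_content t (graph (fun x => w x + u x) (@I01 R)).
Proof.
move=> t1 ts Cw mw [Cu u0 uE] uj.
apply: (rough_lower rough (a := u (y j) / h (y j)) (j := j) (C01D Cw Cu) mw _ _ t1 ts).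
  by rewrite mulf_neq0 // invr_neq0 // (rough_node rough).
move=> x px; congr (_ + _); apply: (mulfI (rough_node rough j)); rewrite uE //.
by field; exact: (rough_node rough).
Qed.

Lemma bundle_eq0 u : bundle u -> (forall j, u (y j) = 0) -> u = @zerof R.
Proof.
move=> [_ u0 uE] uy; apply/funext => x.
have [px|px] := pselect (forall j, phi j x = 0); first exact: u0.
have [j pj] : exists j, phi j x != 0.
  by apply: contrapT => N; apply: px => j; apply/eqP/negPn/negP => pj; apply: N; exists j.
by apply: (mulfI (rough_node rough j)); rewrite uE // uy !mulr0.
Qed.

End Bundles.

(** * Construction of the extension and conclusion *)

Section Spaceability.
Variables (R : realType) (s : R).
Hypotheses (s_gt1 : 1 < s) (s_le2 : s <= 2).

(* Vandermonde, through interpolation polynomials. *)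
Lemma power_sums_eq0 n (c t : 'I_n -> R) : injective t ->
  (forall j, \sum_(i < n) c i * t i ^+ j = 0) -> forall i, c i = 0.
Proof.
move=> tinj ct i0.
have cp (q : {poly R}) : \sum_(i < n) c i * q.[t i] = 0.
  under eq_bigr do rewrite horner_coef mulr_sumr.
  rewrite exchange_big /= big1 // => k _.
  under eq_bigr do rewrite mulrCA.
  by rewrite -mulr_sumr ct mulr0.
have := cp (\prod_(i < n | i != i0) ('X - (t i)%:P)).
rewrite (bigD1 i0) //= [X in _ + X]big1 ?addr0 => [|i ii0]; last first.
  by rewrite horner_prod (bigD1 i) //= hornerXsubC subrr mul0r mulr0.
move/eqP; rewrite mulf_eq0 => /orP[/eqP //|].
rewrite horner_prod prodf_seq_eq0 => /hasP[i _ /andP[ii0]].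
by rewrite hornerXsubC subr_eq0 => /eqP/tinj ii; rewrite ii eqxx in ii0.
Qed.

Lemma spaceable_extension n (f : nat -> R -> R) (W : set (R -> R)) :
  Defs.subspace W -> (forall i, (i < n)%N -> W (f i)) ->
  W `<=` lspan [set f i | i in `I_n] -> W `<=` Hs s `|` [set @zerof R] ->
  exists V, [/\ has_dim R V, Defs.closedC V, W `<=` V & V `<=` Hs s `|` [set @zerof R]].
Proof.
move=> sW Wf Wspan WH; have WC : W `<=` @C01 R by case: sW.
have fC i : (i < n)%N -> C01 (f i) by move=> /Wf/WC.
have [P [X [projP Pf]]] := point_projection_exists sW Wf.
have [delta [delta0 fmod]] := common_modulus fC.
have [h [phi [y [rough phiX]]]] := rough_system_exists X s_gt1 s_le2 delta0.
have Wmod w : W w -> has_modulus delta w.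
  move=> /Wspan; apply: lspan_modulus => b [i lin <-]; [exact: fC|exact: fmod].
have [_ [P0W [WD WZ]]] := sW.
pose H := bundle h phi y; have [HC [H0 [HD HZ]]] := bundle_subspace h phi y.
have PN u v : P (fun x => u x - v x) = (fun x => P u x - P v x).
  rewrite (_ : (fun x => u x - v x) = (fun x => u x + -1 * v x)); last by apply/funext => x; rewrite mulN1r.
  by rewrite (projD projP) (projZ projP); apply/funext => x; rewrite mulN1r.
have PW w : W w -> P w = w.
  move=> /Wspan; suff sF : Defs.subspace [set w | C01 w /\ P w = w].
    by move=> /(lspan_sub sF)[] // b [i lin <-]; split; [exact: fC|exact: Pf].
  have [CC [C0 [CD CZ]]] := @subspace_C01 R.
  split; first by move=> u [].
  split; first by split => //; apply: (proj_vanish projP).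
  split; first by move=> u v [Cu Pu] [Cv Pv]; split; [exact: CD|rewrite (projD projP) Pu Pv].
  by move=> a u [Cu Pu]; split; [exact: CZ|rewrite (projZ projP) Pu].
have PH u : H u -> P u = @zerof R.
  move=> [_ u0 _]; apply: (proj_vanish projP) => x xX; apply: u0 => j; exact: phiX.
(* This is the sum of [W] and [H]: [P] fixes [W] and kills [H], whose members vanish on [X]. Testing
   g - P g makes closedness a matter of pointwise limits, since [P] is continuous at each point for
   the uniform norm. *)
pose V := [set g | C01 g /\ H (fun x => g x - P g x)].
have sV : Defs.subspace V.
  split; first by move=> g [].
  split.
    split; first exact: C01_zerof.
    by rewrite PW // (_ : (fun x => _) = @zerof R) //; apply/funext => x; rewrite subrr.
  split.
    move=> u v [Cu Hu] [Cv Hv]; split; first exact: C01D.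
    rewrite (projD projP) (_ : (fun x => _) = (fun x => (u x - P u x) + (v x - P v x))).
      exact: HD.
    by apply/funext => x; ring.
  move=> a u [Cu Hu]; split; first exact: C01Z.
  rewrite (projZ projP) (_ : (fun x => _) = (fun x => a * (u x - P u x))); first exact: HZ.
  by apply/funext => x; ring.
have HV : H `<=` V.
  move=> u Hu; split; first exact: HC.
  by rewrite PH // (_ : (fun x => _) = u) //; apply/funext => x; rewrite subr0.
have VH : V `<=` Hs s `|` [set @zerof R].
  move=> g [Cg Hg]; set u := (fun x => g x - P g x) in Hg.
  have gE : g = (fun x => P g x + u x) by apply/funext => x; rewrite /u addrC subrK.
  have WPg := proj_in projP g; have CPg := WC _ WPg.
  have [u0|/existsNP[j /eqP uj]] := pselect (forall j, u (y j) = 0).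
    have uz := bundle_eq0 rough Hg u0.
    suff -> : g = P g by exact: WH.
    by apply/funext => x; apply/eqP; rewrite -subr_eq0; apply/eqP; exact: (congr1 (fun F => F x) uz).
  left; split => //; apply: dimH_eq => // [t st|t t1 ts]; rewrite gE.
    apply: (bundle_perturbation rough) => //.
    have [[_ dP]|/= ->] := WH _ WPg; first exact: dimH_null_content dP.
    rewrite (_ : @zerof R = fun x => 0 * id01 x); last by apply/funext => x; rewrite mul0r.
    by apply: null_content_id01; exact: lt_trans st.
  apply: (bundle_wild rough t1 ts CPg _ Hg uj); exact: Wmod.
exists V; split => //; last first.
- move=> w Ww; split; first exact: WC.
  by rewrite PW // (_ : (fun x => _) = @zerof R) //; apply/funext => x; rewrite subrr.
- move=> g Cg clg; split => //; apply: (@bundle_closed _ h phi y).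
    have [_ [_ [CD CZ]]] := @subspace_C01 R.
    rewrite (_ : (fun x => _) = (fun x => g x + -1 * P g x)); last by apply/funext => x; rewrite mulN1r.
    by apply: CD => //; apply: CZ; apply: WC; exact: (proj_in projP).
  move=> x z; have [Cx Cx0 CxP] := proj_bound projP x; have [Cz Cz0 CzP] := proj_bound projP z.
  exists (1 + Cx + Cz) => e e0; have [g' [[Cg' Hg'] g'e]] := clg e e0.
  have Cd : C01 (fun x => g' x - g x).
    have [_ [_ [CD CZ]]] := @subspace_C01 R.
    rewrite (_ : (fun x => _) = (fun x => g' x + -1 * g x)); last by apply/funext => v; rewrite mulN1r.
    by apply: CD => //; exact: CZ.
  have small v : `|g' v - g v| <= e by apply: ltW; exact: supnorm_lt Cd e0 g'e v.
  have bx := CxP _ _ small; have bz := CzP _ _ small; rewrite PN in bx bz.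
  have Cxe : 0 <= Cx * e by rewrite mulr_ge0 // ltW.
  have Cze : 0 <= Cz * e by rewrite mulr_ge0 // ltW.
  exists (fun v => g' v - P g' v); split => //.
    rewrite (_ : _ - _ = (g' x - g x) - (P g' x - P g x)); last by ring.
    apply: (le_trans (ler_normB _ _)); rewrite !mulrDl mul1r.
    by apply: le_trans (lerD (small x) bx) _; rewrite lerDl.
  rewrite (_ : _ - _ = (g' z - g z) - (P g' z - P g z)); last by ring.
  apply: (le_trans (ler_normB _ _)); rewrite !mulrDl mul1r.
  by apply: le_trans (lerD (small z) bz) _; rewrite lerD2r lerDl.
split => //.
have /choice[U UP] : forall t, exists u, H u /\ (0 < t -> t < 1 -> forall j, u (y j) = t ^+ j * h (y j)).
  move=> t; have [/andP[t0 t1]|N] := pselect (0 < t < 1); last first.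
    by exists (@zerof R); split => // t0 t1; case: N; rewrite t0.
  by have [u Hu uy] := bundle_geometric rough t0 t1; exists u.
pose I : set R := [set t | 0 < t < 1].
have iU : lin_indep (U @` I).
  move=> m c v vinj vU cv0.
  have /choice[t tP] : forall i, exists t, I t /\ U t = v i.
    by move=> i; have [t It Ut] := vU i; exists t.
  apply: (@power_sums_eq0 _ c t).
    by move=> i j tij; apply: vinj; have [_ <-] := tP i; have [_ <-] := tP j; rewrite tij.
  move=> j; apply: (mulIf (rough_node rough j)); rewrite mul0r mulr_suml.
  rewrite -[RHS]/(@zerof R (y j)) -cv0 /lincomb; apply: eq_bigr => i _.
  have [/andP[t0 t1] <-] := tP i; have [_ UE] := UP (t i).
  by rewrite (UE t0 t1) mulrA.
have UV : U @` I `<=` V by move=> _ [t _ <-]; apply: HV; have [] := UP t.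
have [B UB basisB] := basis_extension sV UV iU.
exists B; split => //.
have BC : B `<=` @C01 R by case: basisB => BV _ g /BV[].
apply: Cantor_Bernstein; first exact: card_le_trans (subset_card_le BC) (card_C01_le R).
(* A logistic injection of the line into (0,1); the parameter t is recovered from [U t] at the node
   [y 1], where the value is t h (y 1). *)
pose sigma (x : R) := (1 + expR x)^-1.
have sI x : I (sigma x).
  have := expR_gt0 x => ex; rewrite /I /sigma /= invr_gt0 invf_lt1; first by apply/andP; split; lra.
  by lra.
have sU x : U (sigma x) (y 1%N) = sigma x * h (y 1%N).
  by have /andP[s0 s1] := sI x; have [_ UE] := UP (sigma x); rewrite UE // expr1.
have sinj : {in [set: R] &, injective (U \o sigma)}.
  move=> x x' _ _ /= Uxx; apply: expR_inj; apply: (addrI 1); apply: invr_inj.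
  by apply: (mulIf (rough_node rough 1%N)); rewrite -!sU Uxx.
rewrite -(card_le_eql (inj_card_eq sinj)); apply: subset_card_le.
by move=> _ [x _ <-]; apply: UB; exists (sigma x).
Qed.

Lemma nat_card_le_real : ([set: nat] #<= [set: R])%card.
Proof.
apply/pcard_injP; exists (fun n => n%:R) => m n _ _ /eqP.
by rewrite eqr_nat => /eqP.
Qed.

(** Lineability also comes from the extension: starting from the zero space it gives a space of
    dimension continuum, of which p basis vectors are kept. *)
Lemma spaceable_ord (p : nat) : spaceable 'I_p R (Hs s).
Proof.
have I_ord : (`I_p #= [set: 'I_p])%card := card_II.
split; last first.
  move=> W [sW [B [[BW [iB genB]] Bp]]] WH.
  have /card_set_bijP[f [fB finj fsurj]] := card_eq_trans I_ord (card_esym Bp).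
  have [] := @spaceable_extension p f W sW _ _ WH.
  - by move=> i ip; apply: BW; exact: fB.
  - move=> w /genB[n [c [v [Bv ->]]]]; exists n, c, v; split => // i.
    by have [k kp <-] := fsurj _ (Bv i); exists k.
  by move=> V [dV cV WV VH]; exists V.
have [] := @spaceable_extension 0 (fun _ => @zerof R) [set @zerof R].
- split; first by move=> _ ->; exact: C01_zerof.
  split; first by [].
  split; first by move=> _ _ -> ->; apply/funext => x; rewrite /zerof addr0.
  by move=> a _ ->; apply/funext => x; rewrite /zerof mulr0.
- by [].
- move=> _ ->; exists 0%N, (fun=> 0), (fun=> @zerof R); split; first by case.
  by apply/funext => x; rewrite /lincomb big_ord0.
- by move=> w; right.
move=> V [[sV [B [[BV [iB genB]] BR]]] _ _ VH].
have VC : V `<=` @C01 R by case: sV.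
have : ([set: nat] #<= B)%card by rewrite (card_le_eqr BR) nat_card_le_real.
move=> /pcard_leP/injfunPex[/= b bB binj].
have bpB : b @` `I_p `<=` B by move=> _ [i _ <-]; exact: bB.
exists (lspan (b @` `I_p)); split.
  apply: has_dim_lspan; first by move=> g /bpB/BV/VC.
    by move=> n c v vinj vb; apply: iB => // i; exact: bpB.
  apply: card_eq_trans I_ord; apply: inj_card_eq => m n _ _.
  by apply: binj; rewrite in_setT.
by apply: subset_trans VH; apply: lspan_sub => // g /bpB/BV.
Qed.

End Spaceability.

Theorem theorem3p15 (R : realType) (s : R) (TA : Type) (p : nat) :
  1 < s <= 2 ->
  ([set: nat] #<= [set: TA])%card ->
  (p = 1%N \/ p = 2%N) ->
  spaceable 'I_p R (Hs s) /\
  (forall TB : Type,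
     ([set: TA] #<= [set: TB])%card -> ~ ([set: TB] #<= [set: TA])%card ->
     ~ spaceable TA TB (Hs s)).
Proof.
move=> /andP[s1 s2] natTA _; split; first exact: spaceable_ord.
by move=> TB _ _; exact: infinite_not_spaceable.
Qed.
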